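(* Let $\xi$ be a non-negative integer-valued random variable with $\mathbb{E}\xi=1$ and $0<\mathrm{Var}(\xi)<\infty$, and let $\mathcal{T}_n$ be the Galton-Watson tree with offspring distribution $\xi$ conditioned to have $n$ nodes. Assume $p_1:=\mathbb{P}(\xi=1)>0$. Let $\omega_n\to\infty$ be an arbitrary sequence and $h_n\to\infty$ a sequence of positive integers. For an integer $h$ let $\mathcal{A}_{h,1}$ be the set of all possible complete $1$-ary trees (chains) of height at most $h$. (i) If $h_n\le(\log n-\omega_n)/\log\frac1{p_1}$, then with high probability $\mathcal{T}_n$ contains all trees in $\mathcal{A}_{h_n,1}$ as fringe subtrees. (ii) If $h_n\ge(\log n+\omega_n)/\log\frac1{p_1}$, then with high probability $\mathcal{T}_n$ does not contain all trees in $\mathcal{A}_{h_n,1}$ as fringe subtrees. Therefore, with $H_{n,1}:=\max\{h:\mathcal{T}_n\text{ contains all trees in }\mathcal{A}_{h,1}\text{ as fringe subtrees}\}$, $$\frac{H_{n,1}}{\log_{1/p_1}(n)}\to1\quad\text{in probability as }n\to\infty.$$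
   Context: A plane tree is a finite rooted, ordered, unlabeled tree. For a node $v$ of $T$, the fringe subtree $T_v$ consists of $v$ and all its descendants; $T$ contains $T'$ as a fringe subtree if $T_v$ is isomorphic (as a plane tree) to $T'$ for some $v$. The Galton-Watson tree $\mathcal{T}$ is generated from the root by giving each node independently a number of children distributed as $\xi$; a tree $T$ is possible if $\mathbb{P}(\mathcal{T}=T)>0$. The chain of height $h$ is the tree with $h+1$ nodes in which every node except the single leaf has exactly one child. Since $p_1>0$, conditioning on $|\mathcal{T}|=n$ is well defined for all large $n$. ''With high probability'' means with probability tending to $1$ as $n\to\infty$. *)

(* Defs.v *)
From HB Require Import structures.
From mathcomp Require Import all_boot all_order all_algebra.
From mathcomp Require Import all_classical all_reals all_analysis.

Set Implicit Arguments.
Unset Strict Implicit.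
Unset Printing Implicit Defensive.

Import Order.TTheory GRing.Theory Num.Theory.
Import numFieldNormedType.Exports.

Local Open Scope classical_set_scope.
Local Open Scope ring_scope.

(* In [Node ts], the list [ts] holds the subtrees of the children, in order, so
   isomorphism of plane trees is Leibniz equality. *)
Inductive ptree : Type := Node of seq ptree.

Definition children (t : ptree) : seq ptree := let: Node ts := t in ts.

Fixpoint nnodes (t : ptree) : nat :=
  let: Node ts := t in (sumn (map nnodes ts)).+1.

(* Nodes are addressed by Ulam-Harris words: [::] is the root and [rcons v i]
   is the i-th child (counting from 0) of [v]. [fringe_at t v] is the fringe
   subtree of [t] at [v], or [None] if [v] is not a node of [t]. *)
Fixpoint fringe_at (t : ptree) (v : seq nat) : option ptree :=
  if v is i :: v' then
    if onth (children t) i is Some c then fringe_at c v' else None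
  else Some t.

Definition nodes (t : ptree) : set (seq nat) :=
  [set v | fringe_at t v <> None].

Definition contains_fringe (t s : ptree) : Prop :=
  exists v, fringe_at t v = Some s.

Definition chain (h : nat) : ptree := iter h (fun t => Node [:: t]) (Node [::]).

Definition mutually_independent (I : eqType) d d' (T : measurableType d)
    (T' : measurableType d') (R : realType) (P : probability T R)
    (X : I -> {RV P >-> T'}) : Prop :=
  forall (s : seq I) (A : I -> set T'), uniq s ->
    (forall i, measurable (A i)) ->
    fine (P [set w | forall i, i \in s -> A i (X i w)]) =
    \prod_(i <- s) fine (P (X i @^-1` A i)).

(* [X v] is the number of children of the (potential) node [v]. *)
Definition iid_copies d0 (T0 : measurableType d0) d (T : measurableType d)
    (R : realType) (P0 : probability T0 R) (xi : {RV P0 >-> nat})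
    (P : probability T R) (X : seq nat -> {RV P >-> nat}) : Prop :=
  mutually_independent X /\
  forall v (A : set nat), measurable A ->
    distribution P (X v) A = distribution P0 xi A.

(* The Galton-Watson tree at the outcome [w], possibly infinite, as its set of
   nodes: a node [v] has the children [rcons v i] for [i < X v w]. *)
Definition gw_tree d (T : measurableType d) (R : realType)
    (P : probability T R) (X : seq nat -> {RV P >-> nat}) (w : T) :
    set (seq nat) :=
  [set u | forall v i, prefix (rcons v i) u -> (i < X v w)%N].

Definition gw_event d (T : measurableType d) (R : realType)
    (P : probability T R) (X : seq nat -> {RV P >-> nat}) (E : set ptree) :
    set T :=
  [set w | exists2 t, gw_tree X w = nodes t & E t].

Definition possible d (T : measurableType d) (R : realType)
    (P : probability T R) (X : seq nat -> {RV P >-> nat}) (t : ptree) : Prop :=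
  (0 < P (gw_event X [set t]))%E.

(* The probability that the tree conditioned to have [n] nodes lies in [E]; the
   value is 0, by x / 0 = 0, when the conditioning event is null. *)
Definition cgw_prob d (T : measurableType d) (R : realType)
    (P : probability T R) (X : seq nat -> {RV P >-> nat}) (n : nat)
    (E : set ptree) : R :=
  let size_n := gw_event X [set t | nnodes t = n] in
  fine (P (gw_event X E `&` size_n)) / fine (P size_n).

Definition whp d (T : measurableType d) (R : realType)
    (P : probability T R) (X : seq nat -> {RV P >-> nat})
    (E : nat -> set ptree) : Prop :=
  cgw_prob X n (E n) @[n --> \oo] --> (1 : R).

Definition unary_trees d (T : measurableType d) (R : realType)
    (P : probability T R) (X : seq nat -> {RV P >-> nat}) (h : nat) :
    set ptree :=
  [set t | possible X t /\ exists2 j, (j <= h)%N & t = chain j].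

Definition contains_all_unary d (T : measurableType d) (R : realType)
    (P : probability T R) (X : seq nat -> {RV P >-> nat}) (h : nat) :
    set ptree :=
  [set t | forall s, unary_trees X h s -> contains_fringe t s].

(* The maximum of the set of heights, with default value 0 if there is none. *)
Definition max_unary_height d (T : measurableType d) (R : realType)
    (P : probability T R) (X : seq nat -> {RV P >-> nat}) (t : ptree) : nat :=
  xget 0%N [set h | contains_all_unary X h t /\
                    forall k, contains_all_unary X k t -> (k <= h)%N].

Definition cvg_in_prob d (T : measurableType d) (R : realType)
    (P : probability T R) (X : seq nat -> {RV P >-> nat})
    (Y : nat -> ptree -> R) (c : R) : Prop :=
  forall eps : R, 0 < eps ->
    cgw_prob X n [set t | eps < `|Y n t - c|] @[n --> \oo] --> (0 : R).

(* Main.v *)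
Require Import Defs.
From mathcomp Require Import all_boot all_order all_algebra.
From mathcomp Require Import all_classical all_reals all_analysis.
From mathcomp Require Import measurable_realfun.
From mathcomp Require Import zify ring lra.

Set Implicit Arguments.
Unset Strict Implicit.
Unset Printing Implicit Defensive.

Import Order.TTheory GRing.Theory Num.Theory.
Import numFieldNormedType.Exports.

Local Open Scope classical_set_scope.
Local Open Scope ring_scope.

(** A plane tree is determined by its Lukasiewicz word, the outdegrees in
    depth-first order, and the Galton-Watson tree gives a word the product of the
    probabilities of its letters. Conditioning on the size [n] therefore yields a
    quotient of finite weighted sums over words of length [n], and the chain of
    height [h] is a fringe subtree exactly when [h] ones followed by a zero occur
    as consecutive letters ([contains_chain_infix]).

    Delete the ones. What remains, the skeleton, codes a tree without unary
    nodes, and the word is recovered from the lengths of the runs of ones before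
    the letters of the skeleton. If the skeleton has [m] letters and there are [M]
    ones, the run lengths form a composition of [M] into [m] parts; as all words
    with this skeleton have the same weight, the composition is uniformly
    distributed ([luk_event_le]). A given run has length at least [h] with
    probability close to (M / n) ^ h, and long runs at different letters are
    negatively correlated because binomial coefficients are log-concave. More than
    half of the letters of the skeleton are zeros, so that the number of fringe
    chains of height [h] has a mean of order n * (M / n) ^ h and a variance at
    most its mean: the first and the second moment method apply ([chain_upper],
    [chain_lower]).

    It remains to see that M / n is so close to p_1 that its power [h], with [h]
    of order log n, may be replaced by that of p_1 up to a constant factor. For
    independent letters Chernoff's bound shows that a relative deviation n^(-1/8)
    has probability at most 2 exp (- n^(3/4) / 8) ([ones_concentrate]). This survives the
    conditioning since the tree has size [n] with probability at least
    exp (- C sqrt n) ([luk_mass_subexp]): by the cycle lemma this probability is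
    at least 1 / n times the probability that [n] independent letters have sum
    [n - 1]; by Chebyshev's inequality the sum of the first letters is off by
    order sqrt n, and order sqrt n further letters, chosen among 0, 1 and some [j]
    above 1 of positive probability, correct it.

    Hence the chain of height [h] is present or absent with high probability
    according to whether n * p_1 ^ h tends to infinity or to 0
    ([chain_bounds], [cgw_chain_bounds]), which gives the two thresholds and the
    concentration of the maximal height. *)

(** * Plane trees as words *)

(** The children are quantified through [onth] because [fringe_at] reaches them
    that way. *)
Lemma ptree_nested_ind (Q : ptree -> Prop) :
  (forall ts, (forall i t, onth ts i = Some t -> Q t) -> Q (Node ts)) ->
  forall t, Q t.
Proof.
move=> IH; fix F 1 => -[ts]; apply: IH.
elim: ts => [|t ts IHts] i u; first (rewrite onth0n; discriminate).
by case: i => [/Some_inj <-|i]; [apply: F|apply: IHts].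
Qed.

(** The Lukasiewicz word: the outdegrees in depth-first order. *)
Fixpoint enc (t : ptree) : seq nat :=
  let: Node ts := t in size ts :: flatten (map enc ts).

(** A word is decoded from right to left by a stack machine: the letter [a] pops
    [a] trees and pushes their common parent. *)
Definition push (a : nat) (st : seq ptree) : seq ptree :=
  Node (take a st) :: drop a st.

Definition parse : seq nat -> seq ptree := foldr push [::].

(** The height of the stack; the truncated subtraction matches [drop] on a stack
    that is too short. *)
Definition depth : seq nat -> nat := foldr (fun a d => (d - a).+1) 0%N.

(** The stack is always high enough. *)
Fixpoint wf (s : seq nat) : bool :=
  if s is a :: s' then wf s' && (a <= depth s')%N else true.

Definition luk (s : seq nat) : bool := wf s && (depth s == 1%N).

Lemma size_parse s : size (parse s) = depth s.
Proof. by elim: s => //= a s IH; rewrite size_drop -IH. Qed.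

Lemma parse_cat_flatten_enc ts u :
  (forall i t, onth ts i = Some t -> forall u, parse (enc t ++ u) = t :: parse u) ->
  parse (flatten (map enc ts) ++ u) = ts ++ parse u.
Proof.
elim: ts => //= t ts IH H; rewrite -catA.
rewrite (H 0%N t erefl) IH // => i; exact: (H i.+1).
Qed.

Lemma parse_enc t u : parse (enc t ++ u) = t :: parse u.
Proof.
elim/ptree_nested_ind: t u => ts IH u /=.
rewrite /push parse_cat_flatten_enc; first by rewrite take_size_cat ?drop_size_cat.
exact: IH.
Qed.

Lemma depth_enc t u : depth (enc t ++ u) = (depth u).+1.
Proof. by rewrite -!size_parse parse_enc. Qed.

Lemma wf_enc t u : wf u -> wf (enc t ++ u).
Proof.
elim/ptree_nested_ind: t u => ts IH u wu /=.
suff [-> ->] : wf (flatten (map enc ts) ++ u) /\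
    depth (flatten (map enc ts) ++ u) = (size ts + depth u)%N by rewrite leq_addr.
elim: ts IH => //= t ts IHts IH; rewrite -catA depth_enc.
have [|w ->] := IHts; first by move=> i t' H; apply: (IH i.+1).
by split=> //; apply: (IH 0%N).
Qed.

Lemma luk_enc t : luk (enc t).
Proof. by rewrite /luk -(cats0 (enc t)) wf_enc // depth_enc. Qed.

Lemma flatten_enc_parse s : wf s -> flatten (map enc (parse s)) = s.
Proof.
elim: s => //= a s IH /andP[ws le_a].
by rewrite -flatten_cat -map_cat cat_take_drop IH // size_takel // size_parse.
Qed.

Definition dec (s : seq nat) : ptree := head (Node [::]) (parse s).

Lemma decK s : luk s -> enc (dec s) = s.
Proof.
move=> /andP[ws /eqP ds]; have := flatten_enc_parse ws; have := size_parse s.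
rewrite /dec ds; case: (parse s) => [|t [|t' l]] //= _; by rewrite cats0.
Qed.

Lemma encK t : dec (enc t) = t.
Proof. by rewrite /dec -(cats0 (enc t)) parse_enc. Qed.

Lemma nnodes_enc t : nnodes t = size (enc t).
Proof.
elim/ptree_nested_ind: t => ts IH /=; congr _.+1.
elim: ts IH => //= t ts IHts IH; rewrite size_cat (IH 0%N t erefl) IHts //.
by move=> i u Hu; apply: (IH i.+1).
Qed.

Lemma depth_size s : (depth s <= size s)%N.
Proof. by elim: s => //= a s IH; lia. Qed.

(** A letter is at most the height of the stack, hence at most the number of
    letters to its right; so [n] letters suffice to code all trees with [n]
    nodes. *)
Lemma wf_letters s : wf s -> all (fun a => a < size s)%N s.
Proof.
elim: s => //= a s IH /andP[/IH ws le_a].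
rewrite ltnS (leq_trans le_a (depth_size s)) /=.
by apply: sub_all ws => b; lia.
Qed.

(** ** Fringe chains are runs of ones followed by a zero *)

Definition chain_word (h : nat) : seq nat := rcons (nseq h 1%N) 0%N.

Lemma enc_chain h : enc (chain h) = chain_word h.
Proof. by elim: h => //= h ->; rewrite cats0. Qed.

Lemma infix_enc_fringe t s v : fringe_at t v = Some s -> infix (enc s) (enc t).
Proof.
elim: v t => [|i v IH] [ts]; first by case=> <-; apply: infix_refl.
rewrite [fringe_at _ _]/=; case E : (onth ts i) => [c|//] /IH infc.
have -> : enc (Node ts) = [:: size ts] ++ flatten (map enc ts) by [].
apply: (infix_trans infc); apply: infix_catl.
elim: ts i E => [i|t ts IHts [[->]|i /IHts]] /=.
- by rewrite onth0n.
- exact: prefix_infix.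
- exact: infix_catl.
Qed.

Lemma contains_fringe_trans t u s :
  contains_fringe t u -> contains_fringe u s -> contains_fringe t s.
Proof.
move=> [v tv] [w uw]; exists (v ++ w).
elim: v t tv => [|i v IH] t /=; first by case=> ->.
by case: (onth _ _) => // c; apply: IH.
Qed.

Lemma contains_fringe_child ts i s :
  onth ts i = Some s -> contains_fringe (Node ts) s.
Proof. by move=> H; exists [:: i]; rewrite /= H. Qed.

(** Parsing from right to left never discards a tree: it is either kept on the
    stack or becomes a child. *)
Lemma parse_cat_contains u x i s : onth (parse x) i = Some s ->
  exists j t, onth (parse (u ++ x)) j = Some t /\ contains_fringe t s.
Proof.
move=> xi; elim: u => [|a u [j [t [ut ts]]]]; first by exists i, s; split=> //; exists [::].
rewrite /= /push.
have [ja|aj] := ltnP j a.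
  exists 0%N, (Node (take a (parse (u ++ x)))); split=> //.
  apply: contains_fringe_trans ts; apply: (@contains_fringe_child _ j).
  have jsz : (j < size (parse (u ++ x)))%N by rewrite -onthTE ut.
  rewrite -ut -{2}(cat_take_drop a (parse (u ++ x))) onth_cat size_take.
  by rewrite -/(minn _ _) leq_min ja jsz.
exists (j - a).+1, t; split=> //=.
by rewrite -ut !onthE map_drop nth_drop subnKC.
Qed.

(** A run of ones followed by a zero codes a chain wherever it occurs: when the
    stack machine has read it, the chain is on top of the stack. *)
Lemma contains_chain_infix t h :
  contains_fringe t (chain h) <-> infix (chain_word h) (enc t).
Proof.
rewrite -enc_chain; split=> [[v]|/infixP[u [u' tE]]]; first exact: infix_enc_fringe.
have [|j [t' []]] := @parse_cat_contains u (enc (chain h) ++ u') 0 (chain h).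
  by rewrite parse_enc.
by rewrite -tE -[enc t]cats0 parse_enc /=; case: j => [|[]] //= -[<-].
Qed.

Lemma contains_chain_le t h j :
  (j <= h)%N -> contains_fringe t (chain h) -> contains_fringe t (chain j).
Proof.
move=> jh H; apply: contains_fringe_trans H _.
exists (nseq (h - j) 0%N); rewrite -{1}(subnK jh).
by elim: (h - j)%N => //= k <-; rewrite addSn.
Qed.

(** * Weighted sums over words *)

Fixpoint words (K n : nat) : seq (seq nat) :=
  if n is n'.+1 then [seq a :: s | a <- iota 0 K, s <- words K n'] else [:: [::]].

Lemma mem_words K n s :
  (s \in words K n) = (size s == n) && all (fun a => a < K)%N s.
Proof.
elim: n s => [|n IH] [|a s] //=.
- by apply/allpairsP => -[[b t] []].
- apply/allpairsP/idP => [[[b t] /= [bK tn [-> ->]]]|/andP[sn /andP[aK sK]]].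
    by move: bK tn; rewrite mem_iota IH eqSS /= add0n => -> /andP[-> ->].
  by exists (a, s); rewrite IH mem_iota /= aK sK andbT -eqSS.
Qed.

Lemma words_uniq K n : uniq (words K n).
Proof.
elim: n => //= n IH; apply: allpairs_uniq; rewrite ?iota_uniq //.
by move=> [a s] [b t] _ _ [-> ->].
Qed.

Section WordSums.
Variable V : nmodType.
Implicit Types F : seq nat -> V.

Lemma big_words K n F : \sum_(s <- words K n.+1) F s =
  \sum_(0 <= a < K) \sum_(s <- words K n) F (a :: s).
Proof. by rewrite /= big_allpairs_dep /index_iota subn0. Qed.

Lemma big_words_cat K m n F : \sum_(s <- words K (m + n)) F s =
  \sum_(s <- words K m) \sum_(t <- words K n) F (s ++ t).
Proof.
elim: m F => [|m IH] F; first by rewrite big_seq1.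
by rewrite addSn !big_words; apply: eq_bigr => a _; rewrite IH.
Qed.

Lemma big_words_rot K n r F : (r <= n)%N ->
  \sum_(s <- words K n) F (rot r s) = \sum_(s <- words K n) F s.
Proof.
move=> /subnKC <-; rewrite big_words_cat addnC big_words_cat exchange_big /=.
rewrite big_seq [RHS]big_seq; apply: eq_bigr => t; rewrite mem_words => /andP[/eqP tn _].
rewrite big_seq [RHS]big_seq; apply: eq_bigr => s; rewrite mem_words => /andP[/eqP sn _].
by rewrite -[X in rot X _]sn rot_size_cat.
Qed.

End WordSums.

(** ** The cycle lemma *)

(** Number of trees coded by a well-formed word; for a suffix it is the level of
    the associated walk. *)
Definition excess (s : seq nat) : int := (size s)%:Z - (sumn s)%:Z.

Lemma wf_excess s : (forall i, (i < size s)%N -> 0 < excess (drop i s)) ->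
  wf s /\ (depth s)%:Z = excess s.
Proof.
elim: s => [|a s IH] H; first by rewrite /excess /=; split=> //; lia.
have [i|ws ds] := IH; first exact: (H i.+1).
by have := H 0%N isT; move: ds; rewrite /excess /= ws => ds; lia.
Qed.

(** Start the word at the first position where the excess of the remaining
    suffix is minimal: every nonempty suffix of the rotated word then has positive
    excess. *)
Lemma cycle_lemma s : (sumn s).+1 = size s ->
  exists2 r, (r < size s)%N & luk (rot r s).
Proof.
move=> sE; set n := size s; set g := fun i => excess (drop i s).
have n_gt0 : (0 < n)%N by rewrite /n -sE.
have ex_r : exists r, (r < n)%N && [forall j : 'I_n, g r <= g j].
  exists [arg min_(i < Ordinal n_gt0 | true) g i]%O; rewrite ltn_ord /=.
  by case: arg_minP => // i _ H; apply/forallP => j; apply: H.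
case: (ex_minnP ex_r) => r /andP[rn /forallP min_r] first_r.
have gt_r j : (j < r)%N -> g r < g j.
  move=> jr; have jn := ltn_trans jr rn; rewrite ltNge; apply/negP => le_jr.
  suff : (r <= j)%N by rewrite leqNgt jr.
  apply: first_r; rewrite jn; apply/forallP => i; exact: le_trans le_jr (min_r i).
have excess_cat u v : excess (u ++ v) = excess u + excess v.
  by rewrite /excess size_cat sumn_cat; lia.
have g_take i : (i <= r)%N -> excess (drop i (take r s)) = g i - g r.
  move=> ir; apply/eqP; rewrite eq_sym subr_eq -excess_cat; apply/eqP.
  rewrite /g; congr excess; rewrite -{1}(cat_take_drop r s) drop_cat.
  have -> : size (take r s) = r by apply: size_takel; apply: ltnW.
  case: ltnP => // ri; have -> : i = r by lia.
  by rewrite subnn drop0 [drop r (take r s)]drop_oversize // size_takel // ltnW.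
have g0 : g 0%N = 1 by rewrite /g drop0 /excess -sE; lia.
exists r => //.
have [|w d] := @wf_excess (rot r s).
  move=> i; rewrite size_rot -/n => i_n; rewrite /rot drop_cat size_drop -/n.
  case: ltnP => [i_small|i_big].
    rewrite drop_drop excess_cat -[take r s]drop0 g_take // g0.
    have ir : (i + r < n)%N by lia.
    by have := min_r (Ordinal ir); rewrite -/(g _) /=; lia.
  rewrite g_take; last by lia.
  by rewrite subr_gt0 gt_r //; lia.
rewrite /luk w; apply/eqP.
suff : (depth (rot r s))%:Z = 1 by lia.
rewrite d /rot excess_cat -/(g r) -[take r s]drop0 g_take // g0.
by lia.
Qed.

Section Weights.
Variables (R : realFieldType) (p : nat -> R).
Hypothesis p_ge0 : forall k, 0 <= p k.

Definition wt (s : seq nat) : R := \prod_(a <- s) p a.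

Lemma wt_ge0 s : 0 <= wt s.
Proof. by apply: prodr_ge0. Qed.

Lemma wt_cat s t : wt (s ++ t) = wt s * wt t.
Proof. by rewrite /wt big_cat. Qed.

Lemma wt_rot r s : wt (rot r s) = wt s.
Proof. by rewrite /rot wt_cat mulrC -wt_cat cat_take_drop. Qed.

(** For [n <= K] this is the probability that the Galton-Watson tree has [n]
    nodes. *)
Definition luk_mass (K n : nat) : R :=
  \sum_(s <- words K n) wt s * (luk s)%:R.

(** Each word of length [n] with letter sum [n - 1] has a rotation that codes a
    tree, rotations preserve the weight, and there are [n] of them. *)
Lemma cycle_mass K n :
  \sum_(s <- words K n) wt s * ((sumn s).+1 == n)%:R <= n%:R * luk_mass K n.
Proof.
apply: (@le_trans _ _ (\sum_(s <- words K n) \sum_(r < n) wt s * (luk (rot r s))%:R)).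
  rewrite big_seq [leRHS]big_seq; apply: ler_sum => s; rewrite mem_words => /andP[/eqP sn _].
  case: eqP => [sE|_]; last by rewrite mulr0 sumr_ge0 // => r _; rewrite mulr_ge0 ?wt_ge0.
  have [|r] := @cycle_lemma s; first by rewrite sE sn.
  rewrite sn => rn luk_r; rewrite (bigD1 (Ordinal rn)) //= luk_r.
  by rewrite lerDl sumr_ge0 // => i _; rewrite mulr_ge0 ?wt_ge0.
rewrite exchange_big /= (eq_bigr (fun=> luk_mass K n)).
  by rewrite sumr_const card_ord mulr_natl.
move=> r _; rewrite /luk_mass.
rewrite -(@big_words_rot _ K n r (fun s => wt s * (luk s)%:R)) 1?ltnW //.
by apply: eq_bigr => s _; rewrite wt_rot.
Qed.

Lemma sum_words_prod K n (f : nat -> R) :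
  \sum_(s <- words K n) \prod_(a <- s) f a = (\sum_(0 <= a < K) f a) ^+ n.
Proof.
elim: n => [|n IH]; first by rewrite big_seq1 big_nil.
rewrite big_words exprS mulr_suml; apply: eq_bigr => a _.
by rewrite -IH mulr_sumr; apply: eq_bigr => s _; rewrite big_cons.
Qed.

Section SecondMoment.
Variables (K : nat) (b v : R).
Let dev (s : seq nat) : R := \sum_(a <- s) (a%:R - 1).
Hypothesis mass_le1 : \sum_(0 <= a < K) p a <= 1.
Hypothesis drift_le : `|\sum_(0 <= a < K) p a * (a%:R - 1)| <= b.
Hypothesis var_le : \sum_(0 <= a < K) p a * (a%:R - 1) ^+ 2 <= v.

Let dev_cons a s : dev (a :: s) = (a%:R - 1) + dev s.
Proof. by rewrite /dev big_cons. Qed.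

Let b_ge0 : 0 <= b. Proof. exact: le_trans drift_le. Qed.

Let v_ge0 : 0 <= v.
Proof.
by apply: le_trans var_le; apply: sumr_ge0 => a _; rewrite mulr_ge0 ?sqr_ge0.
Qed.

Let mass_ge0 : 0 <= \sum_(0 <= a < K) p a.
Proof. exact: sumr_ge0. Qed.

Let wt0 n : \sum_(s <- words K n) wt s = (\sum_(0 <= a < K) p a) ^+ n.
Proof. exact: sum_words_prod. Qed.

Let wt0_ge0 n : 0 <= \sum_(s <- words K n) wt s.
Proof. by apply: sumr_ge0 => s _; apply: wt_ge0. Qed.

Let wt0_le1 n : \sum_(s <- words K n) wt s <= 1.
Proof. by rewrite wt0 exprn_ile1. Qed.

Let dev1 n : `|\sum_(s <- words K n) wt s * dev s| <= n%:R * b.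
Proof.
elim: n => [|n IH]; first by rewrite big_seq1 /dev big_nil mulr0 normr0 mul0r.
rewrite big_words.
have -> : \sum_(0 <= a < K) \sum_(s <- words K n) wt (a :: s) * dev (a :: s) =
   (\sum_(0 <= a < K) p a * (a%:R - 1)) * (\sum_(s <- words K n) wt s) +
   (\sum_(0 <= a < K) p a) * (\sum_(s <- words K n) wt s * dev s).
  rewrite !mulr_suml -big_split /=; apply: eq_bigr => a _.
  rewrite !mulr_sumr -big_split /=; apply: eq_bigr => s _.
  by rewrite /wt big_cons dev_cons -/(wt s); ring.
apply: le_trans (ler_normD _ _) _; rewrite !normrM.
rewrite -natr1 mulrDl mul1r addrC lerD //.
  rewrite -[leRHS]mul1r ler_pM // ger0_norm //.
by rewrite -[leRHS]mulr1 ler_pM // ger0_norm.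
Qed.

Lemma dev2 n : \sum_(s <- words K n) wt s * dev s ^+ 2 <= n%:R * v + n%:R ^+ 2 * b ^+ 2.
Proof.
elim: n => [|n IH]; first by rewrite big_seq1 /dev big_nil expr0n mulr0 !mul0r addr0.
rewrite big_words.
have -> : \sum_(0 <= a < K) \sum_(s <- words K n) wt (a :: s) * dev (a :: s) ^+ 2 =
   (\sum_(0 <= a < K) p a * (a%:R - 1) ^+ 2) * (\sum_(s <- words K n) wt s) +
   2 * (\sum_(0 <= a < K) p a * (a%:R - 1)) * (\sum_(s <- words K n) wt s * dev s) +
   (\sum_(0 <= a < K) p a) * (\sum_(s <- words K n) wt s * dev s ^+ 2).
  rewrite [2 * _]mulr_sumr !mulr_suml -!big_split /=; apply: eq_bigr => a _.
  rewrite !mulr_sumr -!big_split /=; apply: eq_bigr => s _.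
  by rewrite /wt big_cons dev_cons -/(wt s); ring.
have cross : 2 * (\sum_(0 <= a < K) p a * (a%:R - 1)) *
    (\sum_(s <- words K n) wt s * dev s) <= 2 * n%:R * b ^+ 2.
  apply: le_trans (ler_norm _) _; rewrite !normrM.
  rewrite [leRHS](_ : _ = 2 * b * (n%:R * b)); last by ring.
  by rewrite normr_nat; apply: ler_pM; rewrite ?mulr_ge0 ?ler_pM2l.
have first_term : (\sum_(0 <= a < K) p a * (a%:R - 1) ^+ 2) *
    (\sum_(s <- words K n) wt s) <= v.
  rewrite -[leRHS]mulr1 ler_pM // sumr_ge0 // => a _.
  by rewrite mulr_ge0 ?sqr_ge0.
have last_term : (\sum_(0 <= a < K) p a) * (\sum_(s <- words K n) wt s * dev s ^+ 2) <=
    n%:R * v + n%:R ^+ 2 * b ^+ 2.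
  apply: le_trans IH; rewrite -[leRHS]mul1r ler_wpM2r // sumr_ge0 // => s _.
  by rewrite mulr_ge0 ?sqr_ge0 ?wt_ge0.
have b2 : 0 <= b ^+ 2 by apply: sqr_ge0.
rewrite -[n.+1%:R]natr1; have -> : (n%:R + 1) * v + (n%:R + 1) ^+ 2 * b ^+ 2 =
  v + 2 * n%:R * b ^+ 2 + (n%:R * v + n%:R ^+ 2 * b ^+ 2) + b ^+ 2 by ring.
by lra.
Qed.

Lemma dev_sumn s : dev s = (sumn s)%:R - (size s)%:R.
Proof.
elim: s => [|a s IH]; first by rewrite /dev big_nil subrr.
by rewrite dev_cons IH /= natrD -natr1; ring.
Qed.

(** Chebyshev's inequality controls the sum of the first [N] letters up to an
    error of order sqrt N; since the letters 0, 1 and [j] have positive weight,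
    the last letters can then be chosen so that the sum is exactly what a tree
    requires, at the cost of a factor exponential in sqrt N only. *)
Lemma luk_mass_lower_bound N D j (c : R) :
  (2 <= j < K)%N -> (0 < D)%N -> 0 <= c <= 1 -> c <= p 0%N -> c <= p 1%N -> c <= p j ->
  c ^+ (j * D.+1) *
    ((\sum_(0 <= a < K) p a) ^+ N - (N%:R * v + N%:R ^+ 2 * b ^+ 2) / D%:R ^+ 2) <=
  (N + j * D.+1)%:R * luk_mass K (N + j * D.+1).
Proof.
move=> /andP[j2 jK] D0 /andP[c0 c1] cp0 cp1 cpj; set r := (j * D.+1)%N.
apply: le_trans (cycle_mass _ _).
rewrite big_words_cat.
have D2 : 0 < D%:R ^+ 2 :> R by rewrite exprn_gt0 // ltr0n.
apply: (@le_trans _ _ (c ^+ r *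
   (\sum_(s <- words K N) wt s * (1 - dev s ^+ 2 / D%:R ^+ 2)))).
  rewrite ler_wpM2l ?exprn_ge0 //.
  have -> : \sum_(s <- words K N) wt s * (1 - dev s ^+ 2 / D%:R ^+ 2) =
     \sum_(s <- words K N) wt s - (\sum_(s <- words K N) wt s * dev s ^+ 2) / D%:R ^+ 2.
    rewrite mulr_suml -sumrB; apply: eq_bigr => s _; ring.
  by rewrite wt0 lerD2l lerN2 ler_pM2r ?invr_gt0 // dev2.
rewrite mulr_sumr big_seq [leRHS]big_seq; apply: ler_sum => s.
rewrite mem_words => /andP[/eqP sN _].
have rhs_ge0 : 0 <= \sum_(t <- words K r)
    wt (s ++ t) * ((sumn (s ++ t)).+1 == (N + r)%N)%:R.
  by apply: sumr_ge0 => t _; rewrite mulr_ge0 ?wt_ge0.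
have [far|near] := lerP (D%:R ^+ 2) (dev s ^+ 2).
  apply: le_trans rhs_ge0; rewrite mulr_ge0_le0 ?exprn_ge0 // mulr_ge0_le0 ?wt_ge0 //.
  by rewrite subr_le0 ler_pdivlMr // mul1r.
have nearP : (sumn s < N + D)%N /\ (N < sumn s + D)%N.
  have lt_D (x : R) : x ^+ 2 < D%:R ^+ 2 -> x < D%:R.
    move=> h; rewrite ltNge; apply/negP => Dx; move: h; rewrite ltNge lerXn2r ?nnegrE //.
    exact: le_trans Dx.
  have lt1 := lt_D _ near; have lt2 : - dev s < D%:R by apply: lt_D; rewrite sqrrN.
  move: lt1 lt2; rewrite dev_sumn sN -!(ltr_nat R) !natrD => lt1 lt2; split; lra.
suff [t [tr tK tw tE]] : exists t, [/\ size t = r, all (fun a => a < K)%N t,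
    c ^+ r <= wt t & (sumn (s ++ t)).+1 == (N + r)%N].
  rewrite (bigD1_seq t) ?words_uniq ?mem_words ?tr ?eqxx //= tE mulr1 wt_cat.
  apply: (@le_trans _ _ (wt s * wt t)); last first.
    by rewrite lerDl sumr_ge0 // => u _; rewrite mulr_ge0 ?wt_ge0.
  rewrite mulrCA ler_wpM2l ?wt_ge0 //; apply: le_trans tw.
  by rewrite -[leRHS]mulr1 ler_wpM2l ?exprn_ge0 // gerBl divr_ge0 ?sqr_ge0.
(* Zeros lower a sum that is too large. To raise the sum by one, [j - 1] letters
   are used: one [j], and [j - 2] zeros against its surplus. *)
have wt_nseq x a : wt (nseq x a) = p a ^+ x.
  by rewrite /wt big_nseq iter_mulr_1.
pose word x y := nseq x 0%N ++ nseq y j ++ nseq (r - x - y) 1%N.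
have wordP x y : (x + y <= r)%N -> [/\ size (word x y) = r,
    all (fun a => a < K)%N (word x y), c ^+ r <= wt (word x y) &
    sumn (word x y) = (y * j + (r - x - y))%N].
  move=> xy; rewrite /word; move: xy; clearbody r => xy; split.
  - by rewrite !size_cat !size_nseq addnA -subnDA subnKC.
  - rewrite !all_cat !all_nseq jK (ltn_trans _ jK) ?(leq_trans _ j2) //.
    by rewrite (leq_trans _ (ltnW jK)) // !orbT.
  - rewrite !wt_cat !wt_nseq -{1}(subnKC xy) -addnA exprD subnDA exprD.
    by rewrite !ler_pM ?mulr_ge0 ?exprn_ge0 ?lerXn2r ?nnegrE ?exprn_ge0.
  - by rewrite !sumn_cat !sumn_nseq mul0n mul1n (mulnC j).
case: (leqP N (sumn s)) => [sum_big|sum_small].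
  have [|? ? ? E] := wordP (sumn s - N).+1 0%N.
    by clear -j2 nearP sum_big; rewrite /r; nia.
  exists (word (sumn s - N).+1 0%N); split=> //; rewrite sumn_cat E; apply/eqP.
  by clear -sum_big nearP j2; rewrite /r; nia.
have [|? ? ? E] := wordP ((j - 2) * (N - 1 - sumn s))%N (N - 1 - sumn s)%N.
  by clear -j2 nearP sum_small; rewrite /r; nia.
exists (word ((j - 2) * (N - 1 - sumn s))%N (N - 1 - sumn s)%N); split=> //.
rewrite sumn_cat E; apply/eqP.
by clear -sum_small nearP j2; rewrite /r; nia.
Qed.

End SecondMoment.
End Weights.

(** * Compositions *)

Fixpoint comps (m M : nat) : seq (seq nat) :=
  if m is m'.+1 then
    flatten [seq [seq j :: k | k <- comps m' (M - j)] | j <- iota 0 M.+1]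
  else if M == 0%N then [:: [::]] else [::].

Lemma big_comps (V : nmodType) m M (G : seq nat -> V) :
  \sum_(k <- comps m.+1 M) G k =
  \sum_(0 <= j < M.+1) \sum_(k <- comps m (M - j)) G (j :: k).
Proof.
have -> : comps m.+1 M =
  flatten [seq [seq j :: k | k <- comps m (M - j)] | j <- iota 0 M.+1] by [].
rewrite big_flatten big_map /index_iota subn0.
by apply: eq_bigr => j _; rewrite big_map.
Qed.

Lemma comps_size m M k : k \in comps m M -> size k = m /\ sumn k = M.
Proof.
elim: m M k => [|m IH] M k.
  by rewrite /=; case: eqP => [->|_]; rewrite ?inE // => /eqP ->.
case/flattenP => _ /mapP[j jM ->] /mapP[k' /IH[sk sumk] ->].
by move: jM; rewrite mem_iota /= sk sumk; lia.
Qed.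

(** Either the first part vanishes or it can be decreased by one. *)
Lemma big_comps_pascal (V : nmodType) m M (G : seq nat -> V) :
  \sum_(k <- comps m.+1 M.+1) G k = \sum_(k <- comps m M.+1) G (0%N :: k) +
  \sum_(k <- comps m.+1 M) G ((head 0%N k).+1 :: behead k).
Proof.
by rewrite !big_comps big_nat_recl // subn0.
Qed.

Lemma size_comps m M : size (comps m.+1 M) = 'C(M + m, m).
Proof.
have sizeE k N : size (comps k N) = (\sum_(x <- comps k N) 1)%N.
  by rewrite sum1_size.
elim: m M => [|m IHm] M.
  rewrite bin0 sizeE big_comps big_nat_recr //= subnn big_seq1.
  rewrite big_nat big1 // => j /andP[_ jM].
  by rewrite (_ : (M - j == 0)%N = false) ?big_nil //; lia.
elim: M => [|M IHM].
  by rewrite sizeE big_comps big_nat1 -sizeE subnn IHm !add0n !binn.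
have := big_comps_pascal m.+1 M (fun=> 1%N); rewrite -!sizeE => ->.
by rewrite IHm IHM addSnnS [in RHS]addSn binS; apply: addnC.
Qed.

Definition add_nth (i h : nat) (k : seq nat) : seq nat :=
  set_nth 0%N k i (nth 0%N k i + h)%N.

(** Decreasing the [i]-th part by [h] is a bijection between compositions of [M]
    whose [i]-th part is at least [h] and compositions of [M - h]. *)
Lemma big_comps_shift (V : nmodType) m M i h (G : seq nat -> V) : (i < m)%N ->
  \sum_(k <- comps m M | (h <= nth 0 k i)%N) G k =
  if (h <= M)%N then \sum_(k <- comps m (M - h)) G (add_nth i h k) else 0.
Proof.
elim: i m M G => [|i IH] [|m] M G // im; rewrite big_mkcond;
  rewrite (big_comps m M (fun k => if (h <= nth 0%N k _)%N then G k else 0)).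
  transitivity (\sum_(0 <= j < M.+1 | (h <= j)%N) \sum_(k <- comps m (M - j)) G (j :: k)).
    rewrite [RHS]big_mkcond; apply: eq_bigr => j _ /=.
    by case: ifP => _ //; rewrite big1.
  case: leqP => [hM|Mh].
    rewrite (@big_cat_nat _ _ _ h) //=; last by lia.
    rewrite big_nat_cond big1 ?add0r; last by move=> j; lia.
    rewrite big_comps -{1}[h]add0n big_addn -subSn //.
    rewrite [LHS]big_mkcond /=; apply: eq_bigr => j _.
    rewrite leq_addl subnAC -subnDA addnC.
    by apply: eq_bigr => k _; rewrite /add_nth /= addnC.
  by rewrite big_nat_cond big1 // => j; lia.
under eq_bigr => j _ do rewrite -big_mkcond /= IH //.
case: leqP => [hM|Mh].
  rewrite (@big_cat_nat _ _ _ (M - h).+1) //=; last by lia.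
  rewrite [X in _ + X]big_nat_cond [X in _ + X]big1 ?addr0; last first.
    by move=> j /andP[/andP[hj jM] _]; rewrite ifF //; lia.
  rewrite big_comps; rewrite big_nat [RHS]big_nat; apply: eq_bigr => j /andP[_ jM].
  rewrite ifT; last by lia.
  by rewrite subnAC; apply: eq_bigr => k _; rewrite /add_nth.
by rewrite big_nat_cond big1 // => j /andP[/andP[_ jM] _]; rewrite ifF //; lia.
Qed.

(** Compositions of [M - h] into [m] parts, without the truncation of [M - h]
    when [h] exceeds [M]. *)
Definition ncomps (m M h : nat) : nat := if (h <= M)%N then size (comps m (M - h)) else 0%N.

Lemma count_comps_ge m M i h : (i < m)%N ->
  count (fun k => h <= nth 0 k i)%N (comps m M) = ncomps m M h.
Proof.
move=> im; rewrite -sum1_count (big_comps_shift M h (fun=> 1%N) im) /ncomps.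
by case: ifP => // _; apply: sum1_size.
Qed.

Lemma count_comps_ge2 m M i j h : (i < m)%N -> (j < m)%N -> i != j ->
  count (fun k => (h <= nth 0 k i) && (h <= nth 0 k j))%N (comps m M) =
  ncomps m M (2 * h).
Proof.
move=> im jm ij; rewrite -sum1_count /= big_mkcondr.
rewrite (big_comps_shift M h _ im) /ncomps.
have [hM|Mh] := leqP h M; last by rewrite ifF //; lia.
under eq_bigr => k _ do rewrite /add_nth nth_set_nth /= eq_sym (negbTE ij).
rewrite -big_mkcond sum1_count count_comps_ge // /ncomps mul2n -addnn.
rewrite leq_subRL // -subnDA //.
Qed.

(** The quotient (M + m + 1) / (M + 1) decreases in [M], which makes these numbers
    log-concave. *)
Lemma size_compsS m M :
  ((size (comps m.+1 M.+1)) * M.+1 = (size (comps m.+1 M)) * (M + m).+1)%N.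
Proof.
rewrite !size_comps addSn mulnC [RHS]mulnC mul_bin_down.
by congr (_ * _)%N; lia.
Qed.

Lemma size_comps_gt0 m M : (0 < size (comps m.+1 M))%N.
Proof. by rewrite size_comps bin_gt0 leq_addl. Qed.

Section RatioBounds.
Variable R : realFieldType.

Let c (m M : nat) : R := (size (comps m.+1 M))%:R.

Let c_gt0 m M : 0 < c m M.
Proof. by rewrite /c ltr0n size_comps_gt0. Qed.

Let cS m M : c m M.+1 * M.+1%:R = c m M * (M + m).+1%:R.
Proof. by rewrite /c -!natrM size_compsS. Qed.

Let c_logconcave1 m x y : (x <= y)%N -> c m x * c m y.+1 <= c m x.+1 * c m y.
Proof.
move=> xy; have xS : 0 < x.+1%:R :> R by rewrite ltr0n.
have yS : 0 < y.+1%:R :> R by rewrite ltr0n.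
rewrite -(ler_pM2r (mulr_gt0 xS yS)).
rewrite [leLHS](_ : _ = c m x * (x.+1%:R * (c m y.+1 * y.+1%:R))); last by ring.
rewrite [leRHS](_ : _ = (c m x.+1 * x.+1%:R) * y.+1%:R * c m y); last by ring.
rewrite !cS [leLHS](_ : _ = (c m x * c m y) * (x.+1%:R * (y + m).+1%:R)); last by ring.
rewrite [leRHS](_ : _ = (c m x * c m y) * ((x + m).+1%:R * y.+1%:R)); last by ring.
by rewrite ler_pM2l ?mulr_gt0 // -!natrM ler_nat; nia.
Qed.

Let c_logconcave m x h : c m x * c m (x + h + h) <= c m (x + h) ^+ 2.
Proof.
suff H k y : (x <= y)%N -> c m x * c m (y + k) <= c m (x + k) * c m y.
  by rewrite expr2 H // leq_addr.
elim: k => [|k IH] xy; first by rewrite !addn0.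
have IHk := IH xy; rewrite !addnS.
have := @c_logconcave1 m (x + k) (y + k); rewrite leq_add2r => /(_ xy) step.
rewrite -(ler_pM2r (mulr_gt0 (c_gt0 m (x + k)) (c_gt0 m (y + k)))).
rewrite [leLHS](_ : _ = (c m x * c m (y + k)) * (c m (x + k) * c m (y + k).+1)); last by ring.
rewrite [leRHS](_ : _ = (c m (x + k) * c m y) * (c m (x + k).+1 * c m (y + k))); last by ring.
by rewrite ler_pM // mulr_ge0 // ltW.
Qed.

Lemma ncomps_logconcave m M h :
  (ncomps m.+1 M (2 * h))%:R * (size (comps m.+1 M))%:R <= (ncomps m.+1 M h)%:R ^+ 2 :> R.
Proof.
rewrite /ncomps; case: ifP => [h2|_]; last by rewrite mul0r sqr_ge0.
have -> : (h <= M)%N by clear -h2; lia.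
have := c_logconcave m (M - 2 * h) h; rewrite /c.
have E : (M - 2 * h + h = M - h)%N by clear -h2; lia.
by rewrite E subnK //; clear -h2; lia.
Qed.

(** Both estimates bound each of the [h] quotients of consecutive binomial
    coefficients, which lie between [(M - h) / (M + m)] and [M / (M + m)]. *)
Lemma ncomps_upper m M h :
  (ncomps m.+1 M h)%:R * (M + m)%:R ^+ h <= (size (comps m.+1 M))%:R * M%:R ^+ h :> R.
Proof.
rewrite /ncomps; case: leqP => [|_]; last by rewrite mul0r mulr_ge0 ?exprn_ge0.
rewrite -!/(c _ _); elim: h => [|h IH] hM; first by rewrite subn0 !expr0.
have {}IH := IH (ltnW hM); rewrite !exprSr !mulrA.
have step : c m (M - h.+1) * (M + m)%:R <= c m (M - h) * M%:R.
  have E : (M - h = (M - h.+1).+1)%N by clear -hM; lia.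
  have S'_gt0 : 0 < (M - h + m)%:R :> R by rewrite ltr0n E.
  rewrite -(ler_pM2r S'_gt0).
  have := cS m (M - h.+1); rewrite -E -addSn -E => cE.
  rewrite [leLHS](_ : _ = c m (M - h.+1) * (M - h + m)%:R * (M + m)%:R); last by ring.
  rewrite -cE -!mulrA ler_pM2l // -!natrM ler_nat.
  by clear -hM; nia.
apply: le_trans (_ : c m (M - h) * (M + m)%:R ^+ h * M%:R <= _); last by rewrite ler_wpM2r.
rewrite -mulrA [X in _ * X]mulrC mulrA [leRHS](_ : _ = c m (M - h) * M%:R * (M + m)%:R ^+ h).
  by rewrite ler_wpM2r ?exprn_ge0.
by ring.
Qed.

Lemma ncomps_lower m M h : (h <= M)%N ->
  (size (comps m.+1 M))%:R * (M - h)%:R ^+ h <= (ncomps m.+1 M h)%:R * (M + m)%:R ^+ h :> R.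
Proof.
move=> hM; rewrite /ncomps hM -!/(c _ _).
suff H i : (i <= h)%N -> c m M * (M - h)%:R ^+ i <= c m (M - i) * (M + m)%:R ^+ i by exact: H.
elim: i => [|i IH] ih; first by rewrite subn0 !expr0.
have {}IH := IH (ltnW ih); rewrite !exprSr !mulrA.
have step : c m (M - i) * (M - h)%:R <= c m (M - i.+1) * (M + m)%:R.
  have E : (M - i = (M - i.+1).+1)%N by clear -hM ih; lia.
  have S_gt0 : 0 < (M - i)%:R :> R by rewrite ltr0n E.
  rewrite -(ler_pM2r S_gt0).
  have := cS m (M - i.+1); rewrite -E -addSn -E => cE.
  rewrite [leLHS](_ : _ = c m (M - i) * (M - i)%:R * (M - h)%:R); last by ring.
  rewrite cE -!mulrA ler_pM2l // -!natrM ler_nat.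
  by clear -hM ih; nia.
apply: le_trans (_ : c m (M - i) * (M + m)%:R ^+ i * (M - h)%:R <= _).
  by rewrite ler_wpM2r.
rewrite -mulrA [X in _ * X]mulrC mulrA [leRHS](_ : _ = c m (M - i.+1) * (M + m)%:R * (M + m)%:R ^+ i).
  by rewrite ler_wpM2r ?exprn_ge0.
by ring.
Qed.

End RatioBounds.

(** ** The number of long parts *)

Section LongParts.
Variables (R : realFieldType) (m M h : nat) (I : seq nat).
Hypothesis I_uniq : uniq I.
Hypothesis I_lt : all (fun i => i < m.+1)%N I.

Let C := comps m.+1 M.
Let long (k : seq nat) (i : nat) : bool := (h <= nth 0 k i)%N.
Let N (k : seq nat) : R := \sum_(i <- I) (long k i)%:R.

Let sum_bool (T : Type) (r : seq T) (P : pred T) :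
  \sum_(x <- r) (P x)%:R = (count P r)%:R :> R.
Proof. by rewrite -sum1_count [in RHS]big_mkcond natr_sum; apply: eq_bigr => x _; case: (P x). Qed.

Let sumN : \sum_(k <- C) N k = (size I)%:R * (ncomps m.+1 M h)%:R.
Proof.
rewrite exchange_big /= big_seq (eq_bigr (fun=> (ncomps m.+1 M h)%:R)).
  by rewrite -big_seq big_const_seq count_predT iter_addr_0 mulr_natl.
by move=> i /(allP I_lt) im; rewrite sum_bool count_comps_ge.
Qed.

Let sumN2 : \sum_(k <- C) N k ^+ 2 <= (size I)%:R * (ncomps m.+1 M h)%:R +
  (size I)%:R ^+ 2 * (ncomps m.+1 M (2 * h))%:R.
Proof.
have E k : N k ^+ 2 = \sum_(i <- I) \sum_(j <- I) (long k i && long k j)%:R.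
  rewrite expr2 /N mulr_suml; apply: eq_bigr => i _; rewrite mulr_sumr.
  by apply: eq_bigr => j _; rewrite -natrM mulnb.
rewrite (eq_bigr _ (fun k _ => E k)) exchange_big /=.
have row i : i \in I -> \sum_(k <- C) \sum_(j <- I) (long k i && long k j)%:R <=
    (ncomps m.+1 M h)%:R + (size I)%:R * (ncomps m.+1 M (2 * h))%:R :> R.
  move=> iI; rewrite exchange_big /= (bigD1_seq i) //= lerD //.
    rewrite sum_bool (eq_count (a2 := fun k => long k i)); last by move=> k; rewrite andbb.
    by rewrite count_comps_ge // (allP I_lt).
  apply: (@le_trans _ _ (\sum_(j <- I) (ncomps m.+1 M (2 * h))%:R)).
    rewrite big_mkcond big_seq [leRHS]big_seq; apply: ler_sum => j jI.
    case: eqVneq => //= ji; rewrite sum_bool count_comps_ge2 ?(allP I_lt) //.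
    by rewrite eq_sym.
  by rewrite big_const_seq count_predT iter_addr_0 mulr_natl.
apply: le_trans (_ : \sum_(i <- I) ((ncomps m.+1 M h)%:R +
    (size I)%:R * (ncomps m.+1 M (2 * h))%:R) <= _).
  by rewrite big_seq [leRHS]big_seq; apply: ler_sum => i /row.
by rewrite big_const_seq count_predT iter_addr_0 -[_ *+ size I]mulr_natl mulrDr expr2 mulrA.
Qed.

(** Markov's inequality. *)
Lemma count_has_long :
  (count (fun k => has (long k) I) C)%:R <= (size I)%:R * (ncomps m.+1 M h)%:R :> R.
Proof.
rewrite -sumN -sum_bool; apply: ler_sum => k _.
rewrite /N sum_bool ler_nat has_count.
by case: (count (long k) I).
Qed.

(** Chebyshev's inequality; log-concavity says that long parts are pairwise
    negatively correlated, so the variance of their number is at most its mean. *)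
Lemma count_no_long :
  (count (fun k => ~~ has (long k) I) C)%:R * ((size I)%:R * (ncomps m.+1 M h)%:R) <=
  (size C)%:R ^+ 2 :> R.
Proof.
set B := (count _ _)%:R; set l := (size I)%:R; set c1 := (ncomps m.+1 M h)%:R.
set c0 := (size C)%:R.
have c0_gt0 : 0 < c0 by rewrite ltr0n size_comps_gt0.
have l_ge0 : 0 <= l by rewrite ler0n.
have c1_ge0 : 0 <= c1 by rewrite ler0n.
have [->|lc1] := eqVneq (l * c1) 0; first by rewrite mulr0 sqr_ge0.
have lc1_gt0 : 0 < l * c1 by rewrite lt_def lc1 mulr_ge0.
pose mu := l * c1 / c0.
have cheb : B * mu ^+ 2 <= \sum_(k <- C) (N k - mu) ^+ 2.
  rewrite /B -sum_bool mulr_suml; apply: ler_sum => k _.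
  case: hasPn => [no_long|_]; last by rewrite mul0r sqr_ge0.
  rewrite mul1r /N big_seq big1 ?sub0r ?sqrrN // => i /no_long.
  by rewrite /long; case: (h <= _)%N.
have var : \sum_(k <- C) (N k - mu) ^+ 2 <= l * c1.
  have -> : \sum_(k <- C) (N k - mu) ^+ 2 =
      \sum_(k <- C) N k ^+ 2 - 2 * mu * \sum_(k <- C) N k + c0 * mu ^+ 2.
    have -> : c0 * mu ^+ 2 = \sum_(k <- C) mu ^+ 2.
      by rewrite big_const_seq count_predT iter_addr_0 mulr_natl.
    rewrite mulr_sumr -sumrB -big_split; apply: eq_bigr => k _ /=; ring.
  rewrite sumN -/l -/c1.
  have -> : c0 * mu ^+ 2 = mu * (l * c1) by rewrite /mu; field; rewrite gt_eqF.
  suff : l ^+ 2 * (ncomps m.+1 M (2 * h))%:R <= mu * (l * c1).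
    by have := sumN2; rewrite -/l -/c1; lra.
  have -> : mu * (l * c1) = l ^+ 2 * (c1 ^+ 2 / c0).
    by rewrite /mu; field; rewrite gt_eqF.
  by rewrite ler_wpM2l ?sqr_ge0 // ler_pdivlMr // ncomps_logconcave.
have := le_trans cheb var.
have -> : B * mu ^+ 2 = B * (l * c1) / c0 ^+ 2 * (l * c1).
  by rewrite /mu; field; rewrite gt_eqF.
by rewrite -[leRHS]mul1r ler_pM2r // ler_pdivrMr ?exprn_gt0 // mul1r.
Qed.

End LongParts.

(** * Skeletons: reinserting the ones *)

Fixpoint ins (k z : seq nat) : seq nat :=
  match k, z with
  | j :: k', a :: z' => nseq j 1%N ++ a :: ins k' z'
  | _, _ => [::]
  end.

(** Words that do not end in 1 correspond to their subword of letters other than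
    1 together with the lengths of the runs of ones before these letters. *)
Lemma big_words_ins (V : nmodType) K n (F : seq nat -> V) : (1 < K)%N ->
  (forall s, last 0%N s = 1%N -> F s = 0) ->
  \sum_(s <- words K n) F s =
  \sum_(0 <= m < n.+1) \sum_(z <- words K m | 1%N \notin z)
     \sum_(k <- comps m (n - m)) F (ins k z).
Proof.
move=> K1; elim: n F => [|n IH] F F1.
  by rewrite big_nat1 [RHS]big_mkcond !big_seq1.
(* The recursion on [n] splits according to the first letter: a letter other
   than 1 starts the skeleton, a letter 1 lengthens the first run. *)
have skelS m (H : seq nat -> V) : \sum_(z <- words K m.+1 | 1%N \notin z) H z =
    \sum_(0 <= a < K | a != 1%N) \sum_(z <- words K m | 1%N \notin z) H (a :: z).
  rewrite big_mkcond (big_words K m (fun z => if 1%N \notin z then H z else 0)).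
  rewrite [RHS]big_mkcond. apply: eq_bigr => a _.
  under eq_bigr => z _ do rewrite inE negb_or eq_sym.
  by case: eqP => _ /=; [rewrite big1|rewrite -big_mkcond].
have splitS m (H : seq nat -> V) : \sum_(z <- words K m.+1) H z =
    \sum_(0 <= a < K | a != 1%N) \sum_(z <- words K m) H (a :: z) +
    \sum_(z <- words K m) H (1%N :: z).
  rewrite big_words addrC (bigD1_seq 1%N) //= ?iota_uniq // mem_index_iota //.
pose T m n F : V := \sum_(z <- words K m | 1%N \notin z) \sum_(k <- comps m (n - m)) F (ins k z).
have T0 n' G : T 0%N n'.+1 G = 0 by rewrite /T big_mkcond big_seq1 /= big_nil.
have Tdiag G : T n.+1 n.+1 G = \sum_(0 <= a < K | a != 1%N) T n n (fun s => G (a :: s)).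
  rewrite /T skelS; apply: eq_bigr => a _; apply: eq_bigr => z _.
  by rewrite !subnn big_comps big_nat1.
have TS m G : (m < n)%N -> T m.+1 n.+1 G =
   \sum_(0 <= a < K | a != 1%N) T m n (fun s => G (a :: s)) + T m.+1 n (fun s => G (1%N :: s)).
  move=> mn; rewrite /T !skelS -big_split; apply: eq_bigr => a _ /=.
  rewrite -big_split; apply: eq_bigr => z _ /=.
  rewrite subSS (_ : n - m = (n - m.+1).+1)%N; last by lia.
  rewrite big_comps_pascal; congr (_ + _).
  by rewrite big_seq [RHS]big_seq; apply: eq_bigr => -[|j k] // /comps_size[].
rewrite splitS (eq_bigr (fun a => \sum_(0 <= m < n.+1) T m n (fun s => F (a :: s)))); last first.
  move=> a a1; rewrite (IH (fun s => F (a :: s))) // => s.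
  by case: s => [|b s] /= sl; [move: a1; rewrite sl|apply: F1].
rewrite (IH (fun s => F (1%N :: s))); last by move=> [|b s] sl; apply: F1.
rewrite -/(T _ _ _) [RHS]big_nat_recl // -/(T 0%N n.+1 F) T0 add0r.
rewrite [RHS]big_nat_recr // -/(T n.+1 n.+1 F) Tdiag /=.
have -> : \sum_(0 <= m < n) T m.+1 n.+1 F =
   \sum_(0 <= m < n) \sum_(0 <= a < K | a != 1%N) T m n (fun s => F (a :: s)) +
   \sum_(0 <= m < n) T m.+1 n (fun s => F (1%N :: s)).
  rewrite -big_split /= big_nat [RHS]big_nat; apply: eq_bigr => m /andP[_ mn].
  exact: TS.
rewrite exchange_big /= [X in X + _]big_nat_recr //= -!addrA; congr (_ + _).
rewrite addrC; congr (_ + _); rewrite big_nat_recl //.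
have : T 0%N n (fun s => F (1%N :: s)) = 0.
  by case: (n) => [|n']; [rewrite /T big_mkcond !big_seq1 /= F1|exact: T0].
by rewrite /T => ->; rewrite add0r.
Qed.

(** * Comparing words with their skeletons *)

Lemma wf_depth s : wf s -> (depth s + sumn s)%N = size s.
Proof. by elim: s => //= a s IH /andP[/IH <- le_a]; lia. Qed.

Lemma wf_last s : wf s -> last 0%N s = 0%N.
Proof.
elim: s => [|a [|b s] IH] //=; first by rewrite leqn0 => /eqP.
by move=> /andP[ws _]; apply: IH.
Qed.

Lemma wf_ones j s : (0 < depth s)%N ->
  wf (nseq j 1%N ++ s) = wf s /\ depth (nseq j 1%N ++ s) = depth s.
Proof.
move=> ds; elim: j => //= j [-> ->]; rewrite ds andbT; split=> //.
by rewrite subn1 prednK.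
Qed.

(** A unary node can be inserted above any node. *)
Lemma luk_ins k z : size k = size z -> luk (ins k z) = luk z.
Proof.
suff H : size k = size z -> wf (ins k z) = wf z /\ depth (ins k z) = depth z.
  by move=> /H[wE dE]; rewrite /luk wE dE.
elim: k z => [|j k IH] [|a z] //= [/IH[wE dE]].
by have [//|-> ->] := @wf_ones j (a :: ins k z); rewrite /= wE dE.
Qed.

Lemma count_one_ins k z : size k = size z -> 1%N \notin z ->
  count_mem 1%N (ins k z) = sumn k.
Proof.
elim: k z => [|j k IH] [|a z] //= [/IH sE]; rewrite inE negb_or => /andP[a1 /sE].
by rewrite count_cat /= => ->; rewrite count_nseq /= mul1n eq_sym (negbTE a1).
Qed.

Lemma wt_ins (R : realFieldType) (p : nat -> R) k z : size k = size z ->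
  wt p (ins k z) = p 1%N ^+ sumn k * wt p z.
Proof.
elim: k z => [|j k IH] [|a z] //=; first by rewrite /wt big_nil mulr1.
case=> /IH E; rewrite wt_cat {1}/wt big_nseq iter_mulr_1 /wt !big_cons -!/(wt _ _) E.
by rewrite exprD; ring.
Qed.

Lemma prefix_chain_word h j a s : a != 1%N ->
  prefix (chain_word h) (nseq j 1%N ++ a :: s) = (a == 0%N) && (h == j).
Proof.
move=> a1; elim: h j => [|h IH] [|j] /=.
- by rewrite prefix0s eq_sym andbT.
- by rewrite andbF.
- by rewrite eq_sym (negbTE a1) andbF.
- exact: IH.
Qed.

Lemma infix_chain_word h j a s : a != 1%N ->
  infix (chain_word h) (nseq j 1%N ++ a :: s) =
  (a == 0%N) && (h <= j)%N || infix (chain_word h) s.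
Proof.
move=> a1; elim: j => [|j IH].
  have -> : infix (chain_word h) (a :: s) =
    prefix (chain_word h) (nseq 0 1%N ++ a :: s) || infix (chain_word h) s by [].
  by rewrite prefix_chain_word // leqn0.
have -> : infix (chain_word h) (nseq j.+1 1%N ++ a :: s) =
  prefix (chain_word h) (nseq j.+1 1%N ++ a :: s) ||
  infix (chain_word h) (nseq j 1%N ++ a :: s) by [].
rewrite IH prefix_chain_word // orbA -andb_orr; congr (_ && _ || _).
by rewrite [in RHS]leq_eqVlt.
Qed.

Definition zeros (z : seq nat) : seq nat :=
  [seq i <- iota 0 (size z) | nth 0%N z i == 0%N].

Lemma infix_chain_ins h k z : size k = size z -> 1%N \notin z ->
  infix (chain_word h) (ins k z) = has (fun i => h <= nth 0 k i)%N (zeros z).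
Proof.
elim: k z => [|j k IH] [|a z] //=; first by case: h.
case=> /IH E; rewrite inE negb_or eq_sym => /andP[a1 /E {}E].
rewrite infix_chain_word // E /zeros /= -[1%N]addn0 iotaDl filter_map.
by case: (a == 0%N); rewrite /= has_map.
Qed.

Lemma size_zeros z : size (zeros z) = count_mem 0%N z.
Proof.
rewrite size_filter -[in RHS](mkseq_nth 0%N z) /mkseq count_map.
by apply: eq_count.
Qed.

Lemma zeros_uniq z : uniq (zeros z).
Proof. by rewrite filter_uniq ?iota_uniq. Qed.

Lemma zeros_lt z : all (fun i => i < size z)%N (zeros z).
Proof. by apply/allP => i; rewrite mem_filter mem_iota => /andP[_]. Qed.

(** In a tree without unary nodes more than half of the nodes are leaves. *)
Lemma size_zeros_luk z : luk z -> 1%N \notin z -> (size z < 2 * size (zeros z))%N.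
Proof.
move=> /andP[wz /eqP dz] z1; rewrite size_zeros.
have : (2 * size z <= sumn z + 2 * count_mem 0%N z)%N.
  elim: z z1 {wz dz} => //= a z IH; rewrite inE negb_or eq_sym => /andP[a1 /IH].
  by case: a a1 => [|[|a]] //= _; lia.
by have := wf_depth wz; rewrite dz; lia.
Qed.

Section Transfer.
Variables (R : realFieldType) (p : nat -> R) (K n : nat).
Hypothesis p_ge0 : forall k, 0 <= p k.
Hypothesis K1 : (1 < K)%N.

(** Given its skeleton, a weighted word has uniformly distributed run lengths; an
    estimate that holds for every typical skeleton therefore holds on average, up
    to the weight of the atypical words. *)
Lemma luk_event_le (A : pred nat) (E : pred (seq nat)) (u : R) : 0 <= u ->
  (forall m z, (m <= n)%N -> size z = m -> luk z -> 1%N \notin z -> A (n - m)%N ->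
    (count (fun k => E (ins k z)) (comps m (n - m)))%:R <=
    u * (size (comps m (n - m)))%:R) ->
  \sum_(s <- words K n) wt p s * (luk s && E s)%:R <=
  u * luk_mass p K n + \sum_(s <- words K n) wt p s * (~~ A (count_mem 1%N s))%:R.
Proof.
move=> u0 H.
have luk0 s : last 0%N s = 1%N -> luk s = false.
  by move=> s1; apply/negP => /andP[/wf_last]; rewrite s1.
apply: (@le_trans _ _ (\sum_(s <- words K n)
    wt p s * [&& luk s, A (count_mem 1%N s) & E s]%:R +
    \sum_(s <- words K n) wt p s * (~~ A (count_mem 1%N s))%:R)).
  rewrite -big_split; apply: ler_sum => s _ /=; rewrite -mulrDr ler_wpM2l ?wt_ge0 //.
  by case: (luk s); case: (E s); case: (A _); rewrite /= ?addr0 ?add0r.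
rewrite lerD2r; apply: (@le_trans _ _ (u * \sum_(s <- words K n)
    wt p s * (luk s && A (count_mem 1%N s))%:R)); last first.
  rewrite ler_wpM2l // /luk_mass; apply: ler_sum => s _; rewrite ler_wpM2l ?wt_ge0 //.
  by case: (luk s); case: (A _).
rewrite !big_words_ins //; last 2 first.
- by move=> s /luk0 ->; rewrite mulr0.
- by move=> s /luk0 ->; rewrite mulr0.
rewrite mulr_sumr big_nat [leRHS]big_nat; apply: ler_sum => m /andP[_ mn].
rewrite mulr_sumr big_seq_cond [leRHS]big_seq_cond; apply: ler_sum => z.
rewrite mem_words => /andP[/andP[/eqP zm _] z1].
have ins_sum (B : pred (seq nat)) :
  \sum_(k <- comps m (n - m))
     wt p (ins k z) * [&& luk (ins k z), A (count_mem 1%N (ins k z)) & B (ins k z)]%:R =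
  p 1%N ^+ (n - m) * wt p z * (luk z && A (n - m)%N)%:R *
    (count (fun k => B (ins k z)) (comps m (n - m)))%:R.
  rewrite -sum1_count [in RHS]big_mkcond natr_sum mulr_sumr big_seq [RHS]big_seq.
  apply: eq_bigr => k /comps_size[sk sumk].
  rewrite luk_ins ?sk // count_one_ins ?sk // wt_ins ?sk // sumk -!mulrA.
  by case: (luk z); case: (A _); case: (B _); rewrite /= ?mul1r ?mul0r ?mulr0.
rewrite ins_sum.
have := ins_sum predT; rewrite count_predT.
under eq_bigr => k _ do rewrite andbT.
move=> ->; case lA : (luk z && A (n - m)%N); last by rewrite !mulr0 !mul0r mulr0.
move: lA => /andP[lz Anm]; rewrite mulr1 mulrCA ler_wpM2l //; last exact: H.
by rewrite mulr_ge0 ?exprn_ge0 ?wt_ge0.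
Qed.

(** First moment bound; the number of leaves is at most [n]. *)
Lemma chain_upper (A : pred nat) h (b : R) :
  (forall M, A M -> (M%:R <= b * n.-1%:R)) -> 0 <= b ->
  \sum_(s <- words K n) wt p s * (luk s && infix (chain_word h) s)%:R <=
  n%:R * b ^+ h * luk_mass p K n +
  \sum_(s <- words K n) wt p s * (~~ A (count_mem 1%N s))%:R.
Proof.
move=> Ab b0; apply: luk_event_le; first by rewrite mulr_ge0 ?exprn_ge0.
move=> m z mn zm lz z1 /Ab Mb.
case: m zm mn Mb => [/size0nil z0|m zm mn Mb]; first by rewrite z0 in lz.
apply: (@le_trans _ _ ((size (zeros z))%:R * (ncomps m.+1 (n - m.+1) h)%:R)).
  have := @count_has_long R m (n - m.+1) h (zeros z).
  rewrite -{1}zm zeros_lt => /(_ isT); apply: le_trans; rewrite ler_nat.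
  rewrite (@eq_in_count _ _ (fun k => has (fun i => h <= nth 0 k i)%N (zeros z))) //.
  by move=> k /comps_size[sk _]; rewrite infix_chain_ins // sk zm.
have nE : (n - m.+1 + m = n.-1)%N by clear -mn; lia.
have := ncomps_upper R m (n - m.+1) h; rewrite nE => up.
have zn : (size (zeros z))%:R <= n%:R :> R.
  rewrite ler_nat size_filter (leq_trans (count_size _ _)) // size_iota zm //.
rewrite -mulrA; apply: ler_pM => //.
have [n1|n1] := eqVneq n.-1 0%N.
  have M0 : (n - m.+1 = 0)%N by clear -nE n1; lia.
  case: h up => [|h] _; first by rewrite /ncomps leq0n subn0 expr0 mul1r.
  by rewrite /ncomps M0 ltn0 mulr_ge0 ?exprn_ge0.
have n1_gt0 : 0 < n.-1%:R :> R by rewrite ltr0n lt0n.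
rewrite -(ler_pM2r (exprn_gt0 h n1_gt0)); apply: le_trans up _.
rewrite mulrAC mulrC -exprMn ler_wpM2r //.
by rewrite lerXn2r ?nnegrE // mulr_ge0.
Qed.

(** Second moment bound; [l / 2] is a lower bound for the number of leaves. *)
Lemma chain_lower (A : pred nat) h (b l : R) : 0 < b -> 0 < l ->
  (forall M, A M -> [/\ (h <= M)%N, b * n%:R <= (M - h)%:R & l <= (n - M)%:R]) ->
  \sum_(s <- words K n) wt p s * (luk s && ~~ infix (chain_word h) s)%:R <=
  2 / (l * b ^+ h) * luk_mass p K n +
  \sum_(s <- words K n) wt p s * (~~ A (count_mem 1%N s))%:R.
Proof.
move=> b0 l0 Ab; have bh0 : 0 < b ^+ h by apply: exprn_gt0.
apply: luk_event_le; first by rewrite divr_ge0 // mulr_ge0 // ltW.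
move=> m z mn zm lz z1 /Ab[hM Mb ml].
case: m zm mn hM Mb ml => [/size0nil z0|m zm mn hM Mb ml]; first by rewrite z0 in lz.
have nE : (n - m.+1 + m = n.-1)%N by clear -mn; lia.
have n0 : 0 < n%:R :> R by rewrite ltr0n; clear -mn; lia.
set M := (n - m.+1)%N in hM Mb ml *; set c := (size (comps m.+1 M))%:R.
have c0 : 0 < c by rewrite ltr0n size_comps_gt0.
have lz2 : l / 2 <= (size (zeros z))%:R.
  have mE : (n - M = m.+1)%N by rewrite /M; clear -mn; lia.
  have := size_zeros_luk lz z1; rewrite zm => lt_m; rewrite ler_pdivrMr //.
  by apply: le_trans ml _; rewrite -natrM ler_nat mE; clear -lt_m; lia.
have low : c * b ^+ h <= (ncomps m.+1 M h)%:R.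
  rewrite -(ler_pM2r (exprn_gt0 h n0)) -mulrA -exprMn.
  apply: (@le_trans _ _ (c * (M - h)%:R ^+ h)).
    by rewrite ler_wpM2l ?(ltW c0) // lerXn2r ?nnegrE // mulr_ge0 ?(ltW b0).
  apply: le_trans (ncomps_lower R m hM) _; rewrite nE ler_wpM2l //.
  by rewrite lerXn2r ?nnegrE // ler_nat leq_pred.
rewrite (@eq_in_count _ _ (fun k => ~~ has (fun i => h <= nth 0 k i)%N (zeros z))); last first.
  by move=> k /comps_size[sk _]; rewrite infix_chain_ins // sk zm.
have := @count_no_long R m M h (zeros z) (zeros_uniq z).
rewrite -{1}zm zeros_lt => /(_ isT) cheb.
have lb0 : 0 < l / 2 * (c * b ^+ h) by rewrite !mulr_gt0 ?invr_gt0.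
rewrite -(ler_pM2r lb0) [leRHS](_ : _ = c ^+ 2); last first.
  by field; rewrite !gt_eqF.
apply: le_trans cheb; rewrite ler_wpM2l //; apply: ler_pM => //.
- by rewrite divr_ge0 // ltW.
- by rewrite mulr_ge0 // ltW.
Qed.

End Transfer.

(** * The law of the Galton-Watson tree *)

Definition deg (t : ptree) (v : seq nat) : nat :=
  if fringe_at t v is Some s then size (children s) else 0%N.

Fixpoint nodelist (t : ptree) : seq (seq nat) :=
  let: Node ts := t in
  let L := map nodelist ts in
  [::] :: [seq i :: v | i <- iota 0 (size L), v <- nth [::] L i].

Lemma mem_nodelist t v : (v \in nodelist t) <-> nodes t v.
Proof.
rewrite /nodes /=.
elim/ptree_nested_ind: t v => ts IH [|i v] /=; first by rewrite inE.
rewrite inE /= size_map; split.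
  case/allpairsPdep => j [u [jn uj [-> ->]]].
  move: jn uj; rewrite mem_iota /= -onthTE; case E : (onth ts j) => [c|//] _.
  have [jts /(_ (Node [::])) Hj] : (j < size ts)%N /\ forall x0, nth x0 ts j = c.
    by split=> [|x0]; [rewrite -onthTE E|apply: onth_nth].
  by rewrite (nth_map (Node [::])) // Hj => /(IH _ _ E).
case E : (onth ts i) => [c|//] /(IH _ _ E) vc; apply/allpairsPdep; exists i, v.
have its : (i < size ts)%N by rewrite -onthTE E.
split=> //; first by rewrite mem_iota.
by rewrite (nth_map (Node [::])) // (@onth_nth _ (Node [::]) _ _ _ E).
Qed.

Lemma nodelist_uniq t : uniq (nodelist t).
Proof.
elim/ptree_nested_ind: t => ts IH /=; apply/andP; split.
  by apply/allpairsPdep => -[i [v []]].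
apply: allpairs_uniq_dep; rewrite ?iota_uniq //; last by move=> [i u] [j v] _ _ [-> ->].
move=> i; rewrite mem_iota size_map /= => its; rewrite (nth_map (Node [::])) //.
by apply: (IH i); rewrite onthE (nth_map (Node [::])).
Qed.

Lemma map_deg_nodelist t : map (deg t) (nodelist t) = enc t.
Proof.
elim/ptree_nested_ind: t => ts IH /=; congr (_ :: _).
rewrite map_allpairs size_map.
congr flatten; apply: (@eq_from_nth _ [::]); first by rewrite !size_map size_iota.
rewrite size_map size_iota => i its.
rewrite (nth_map 0%N) ?size_iota // nth_iota // add0n !(nth_map (Node [::])) //.
have E : onth ts i = Some (nth (Node [::]) ts i) by rewrite onthE (nth_map (Node [::])).
by rewrite -(IH i) //; apply: eq_map => v; rewrite /deg /= E.
Qed.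

Lemma nodes_rcons t v i : nodes t (rcons v i) <-> nodes t v /\ (i < deg t v)%N.
Proof.
rewrite /nodes /deg /=; elim: v t => [|j v IH] t /=.
  by rewrite -onthTE; case: onth; split=> // -[].
by case: onth => [c|]; [apply: IH|split=> // -[]].
Qed.

Lemma nodes_cons ts i v : (i < size ts)%N ->
  nodes (Node ts) (i :: v) <-> nodes (nth (Node [::]) ts i) v.
Proof. by move=> its; rewrite /nodes /= onthE (nth_map (Node [::])). Qed.

Section GaltonWatson.
Context (R : realType) d0 (T0 : measurableType d0) (P0 : probability T0 R)
  (xi : {RV P0 >-> nat}) d (T : measurableType d) (P : probability T R)
  (X : seq nat -> {RV P >-> nat}).
Hypothesis X_iid : iid_copies xi X.

Definition offspring (k : nat) : R := fine (P0 (xi @^-1` [set k])).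

Lemma gw_tree_rcons w v i :
  gw_tree X w (rcons v i) <-> gw_tree X w v /\ (i < X v w)%N.
Proof.
rewrite /gw_tree /=; split=> [H|[H iv] u j].
  split=> [u j uv|]; last by apply: H; apply: prefix_refl.
  by apply: H; apply: prefix_trans uv _; apply: prefix_rcons.
move=> /prefixP[s]; case/lastP: s => [|s a].
  by rewrite cats0 => /rcons_inj[<- <-].
by rewrite -rcons_cat => /rcons_inj[vE _]; apply: H; rewrite vE prefix_prefix.
Qed.

(** The tree equals [t] as soon as finitely many offspring variables take the
    right values, which makes independence applicable. *)
Lemma gw_tree_nodes w t : gw_tree X w = nodes t <->
  (forall v, v \in nodelist t -> X v w = deg t v).
Proof.
split=> [E v /mem_nodelist vt|H].
  have iff_deg i : (i < X v w)%N <-> (i < deg t v)%N.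
    have := nodes_rcons t v i; rewrite -E gw_tree_rcons => tE.
    have vE : gw_tree X w v by rewrite E.
    by split=> iv; [apply: (proj2 (proj1 tE _))|apply: (proj2 (proj2 tE _))].
  apply/eqP; rewrite eqn_leq; apply/andP; split; rewrite leqNgt; apply/negP => lt.
    by have := proj1 (iff_deg _) lt; rewrite ltnn.
  by have := proj2 (iff_deg _) lt; rewrite ltnn.
apply/seteqP; suff sub v : gw_tree X w v <-> nodes t v by split=> v /sub.
elim/last_ind: v => [|v i IH].
  by split=> // _ v i; case: v.
rewrite gw_tree_rcons nodes_rcons IH.
by split=> -[vt iv]; move: iv; rewrite (H v) //; apply/mem_nodelist.
Qed.

Lemma gw_event_set1 t : gw_event X [set t] =
  [set w | forall v, v \in nodelist t -> [set deg t v] (X v w)].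
Proof.
apply/seteqP; split=> w /=; first by case=> t0 /gw_tree_nodes H <-.
by move=> H; exists t => //; apply/gw_tree_nodes.
Qed.

Lemma gw_event_inj w t t' : gw_tree X w = nodes t -> gw_tree X w = nodes t' -> t = t'.
Proof.
move=> Et Et'; have E : nodes t = nodes t' by rewrite -Et.
have degE v : nodes t v -> deg t v = deg t' v.
  move=> vt; have := vt; rewrite E => /mem_nodelist vt'.
  by rewrite -(proj1 (gw_tree_nodes w t) Et) ?(proj1 (gw_tree_nodes w t') Et') //; apply/mem_nodelist.
elim/ptree_nested_ind: t t' E degE {Et Et'} => ts IH [ts'] E degE.
congr Node; have sizeE : size ts = size ts' by apply: (degE [::]).
apply: (@eq_from_nth _ (Node [::])) => // i its.
have its' : (i < size ts')%N by rewrite -sizeE.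
have onthN l : (i < size l)%N -> onth l i = Some (nth (Node [::]) l i).
  by move=> il; rewrite onthE (nth_map (Node [::])).
apply: (IH i); first exact: onthN.
  by apply/seteqP; split=> v vt; move: vt; rewrite -!nodes_cons // E.
move=> v /(proj2 (nodes_cons v its)) /degE.
by rewrite /deg /= !onthN.
Qed.

Lemma measurable_gw_event_set1 t : measurable (gw_event X [set t]).
Proof.
rewrite gw_event_set1; elim: (nodelist t) => [|v s IH].
  by rewrite (_ : [set w | _] = setT) //; apply/seteqP; split.
rewrite (_ : [set w | _] = X v @^-1` [set deg t v] `&`
    [set w | forall u, u \in s -> [set deg t u] (X u w)]); last first.
  apply/seteqP; split=> w /= => [H|[Hv H] u]; last by rewrite inE => /predU1P[->|/H].
  by split=> [|u us]; apply: H; rewrite inE ?eqxx ?us ?orbT.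
apply: measurableI => //; rewrite -[_ @^-1` _]setTI.
exact: measurable_funP.
Qed.

Lemma P_gw_event_set1 t : P (gw_event X [set t]) = (wt offspring (enc t))%:E.
Proof.
have fin : P (gw_event X [set t]) \is a fin_num.
  by apply: fin_num_measure; apply: measurable_gw_event_set1.
rewrite -(fineK fin); congr EFin; rewrite gw_event_set1.
have [indep law] := X_iid.
rewrite (indep _ (fun v => [set deg t v])) ?nodelist_uniq // /wt -map_deg_nodelist big_map.
apply: eq_bigr => v _; rewrite /offspring.
by have := law v [set deg t v] I; rewrite /distribution /pushforward => ->.
Qed.

Lemma offspring_ge0 k : 0 <= offspring k.
Proof. by rewrite /offspring fine_ge0. Qed.

(** The trees with [n] nodes have finitely many codes, and different trees are
    disjoint events. *)
Lemma P_gw_event_size K n (E : set ptree) : (n <= K)%N ->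
  fine (P (gw_event X E `&` gw_event X [set t | nnodes t = n])) =
  \sum_(s <- words K n) wt offspring s * (luk s && `[< E (dec s) >])%:R.
Proof.
move=> nK; set L := [seq s <- words K n | luk s && `[< E (dec s) >]].
have -> : gw_event X E `&` gw_event X [set t | nnodes t = n] =
    [set w | exists2 s, s \in L & gw_event X [set dec s] w].
  apply/seteqP; split=> w /=.
    case=> -[t wt' Et] [t' wt'' nt']; rewrite -(gw_event_inj wt' wt'') in nt'.
    exists (enc t); last by exists t => //=; rewrite encK.
    rewrite mem_filter luk_enc encK mem_words -nnodes_enc nt' eqxx /=.
    apply/andP; split; first exact/asboolP.
    have := luk_enc t => /andP[/wf_letters]; rewrite -nnodes_enc nt' => H _.
    by apply: sub_all H => a; move=> /leq_trans; apply.
  case=> s; rewrite mem_filter mem_words => /andP[/andP[ls /asboolP Es]].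
  case/andP=> /eqP sn _ [t wt' tE]; rewrite tE in wt'.
  by split; exists (dec s) => //=; rewrite nnodes_enc decK.
transitivity (\sum_(s <- L) wt offspring s); last first.
  rewrite big_filter big_mkcond; apply: eq_bigr => s _.
  by case: ifP => _; rewrite ?mulr1 ?mulr0.
have L_uniq : uniq L by rewrite filter_uniq ?words_uniq.
have L_luk : all luk L by apply/allP => s; rewrite mem_filter => /andP[/andP[]].
suff [_ ->] : measurable [set w | exists2 s, s \in L & gw_event X [set dec s] w] /\
    P [set w | exists2 s, s \in L & gw_event X [set dec s] w] =
    (\sum_(s <- L) wt offspring s)%:E by [].
elim: (L) L_uniq L_luk => [_ _|s l IH /= /andP[sl l_uniq] /andP[ls l_luk]].
  rewrite (_ : [set w | _] = set0) ?measure0 ?big_nil //.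
  by apply/seteqP; split=> w //= -[].
have [ml Pl] := IH l_uniq l_luk.
have -> : [set w | exists2 s0, s0 \in s :: l & gw_event X [set dec s0] w] =
   gw_event X [set dec s] `|` [set w | exists2 s, s \in l & gw_event X [set dec s] w].
  apply/seteqP; split=> w /= => [[u]|[H|[u ul H]]].
  - by rewrite inE => /predU1P[->|ul] H; [left|right; exists u].
  - by exists s; rewrite ?mem_head.
  - by exists u; rewrite // inE ul orbT.
have ms := measurable_gw_event_set1 (dec s).
split; first exact: measurableU.
set A := gw_event X [set dec s]; set B := [set w | _] in ml Pl *.
have PU : A `&` B = set0 -> P (A `|` B) = (P A + P B)%E by move=> AB; apply: measureU.
rewrite PU ?P_gw_event_set1 ?decK // ?Pl ?big_cons ?EFinD //.
apply/seteqP; split=> w //= -[[t wt' tE] [u ul [t' wt'' tE']]].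
have := gw_event_inj wt' wt''; rewrite tE tE' => /(congr1 enc).
by rewrite !decK // ?(allP l_luk) // => su; rewrite su ul in sl.
Qed.

End GaltonWatson.

(** * Moments of the offspring distribution *)

Section Moments.
Context (R : realType) d0 (T0 : measurableType d0) (P0 : probability T0 R)
  (xi : {RV P0 >-> nat}).

Let p := offspring xi.

Lemma integral_offspring (f : nat -> R) : (forall k, 0 <= f k) ->
  (\int[P0]_w (f (xi w))%:E = \sum_(k <oo) (p k * f k)%:E)%E.
Proof.
move=> f0.
have := @ge0_integral_bigcup _ _ _ P0 (fun k => xi @^-1` [set k]) (fun w => (f (xi w))%:E).
have -> : \bigcup_k (xi @^-1` [set k]) = setT.
  by apply/seteqP; split=> // w _; exists (xi w).
move=> ->; first last.
- by move=> i j _ _ [w [/= <- <-]].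
- by move=> w _; rewrite lee_fin.
- apply/measurable_EFinP => _ B _; rewrite setTI.
  rewrite [X in measurable X](_ : _ = xi @^-1` (f @^-1` B)) // -[_ @^-1` _]setTI.
  exact: measurable_funP.
- by move=> k; rewrite -[_ @^-1` _]setTI; apply: measurable_funP.
apply: eq_eseriesr => k _.
have mk : measurable (xi @^-1` [set k]).
  by rewrite -[_ @^-1` _]setTI; apply: measurable_funP.
rewrite (eq_integral (cst (f k)%:E)); last by move=> w; rewrite inE => /= ->.
rewrite integral_cst // /p /offspring EFinM muleC fineK //.
by apply: fin_num_measure.
Qed.

Lemma cvg_offspring (f : nat -> R) (S : R) : (forall k, 0 <= f k) ->
  (\int[P0]_w (f (xi w))%:E = S%:E)%E ->
  (\sum_(0 <= k < n) p k * f k) @[n --> \oo] --> S.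
Proof.
move=> f0; rewrite integral_offspring // => E.
have : (\sum_(0 <= k < n) (p k * f k)%:E)%E @[n --> \oo] --> S%:E.
  rewrite -E; apply: is_cvg_nneseries => k _ _.
  by rewrite lee_fin mulr_ge0 ?offspring_ge0.
move=> /fine_cvgP[_]; apply: cvg_trans; apply: near_eq_cvg; near=> n.
by rewrite /= sumEFin.
Unshelve. all: by end_near.
Qed.

Lemma offspring_mass : (\sum_(0 <= k < n) p k) @[n --> \oo] --> (1 : R).
Proof.
have := @cvg_offspring (fun=> 1) 1 (fun=> ler01); under eq_cvg do under eq_bigr do rewrite mulr1.
apply; rewrite (eq_integral (cst 1%:E)) // integral_cst // mul1e.
exact: probability_setT.
Qed.

Hypothesis mean_xi : ('E_P0[fun w => (xi w)%:R%R] = 1)%E.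

Lemma offspring_drift : (\sum_(0 <= k < n) p k * (k%:R - 1)) @[n --> \oo] --> (0 : R).
Proof.
have mean := @cvg_offspring (fun k => k%:R) 1 (fun k => ler0n _ k).
have {}mean := mean _; rewrite -[X in _ --> X](subrr (1 : R)).
have -> : (fun n => \sum_(0 <= k < n) p k * (k%:R - 1)) =
    (fun n => \sum_(0 <= k < n) p k * k%:R - \sum_(0 <= k < n) p k).
  by apply/funext => n; rewrite -sumrB; apply: eq_bigr => k _; rewrite mulrBr mulr1.
apply: cvgB; last exact: offspring_mass.
by apply: mean; rewrite -mean_xi expectation.unlock.
Qed.

Lemma offspring_var (V : R) : ('V_P0[fun w => (xi w)%:R%R] = V%:E)%E ->
  (\sum_(0 <= k < n) p k * (k%:R - 1) ^+ 2) @[n --> \oo] --> V.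
Proof.
move=> VE; apply: (@cvg_offspring (fun k => (k%:R - 1) ^+ 2)) => [k|]; first exact: sqr_ge0.
rewrite -VE /variance covariance.unlock mean_xi /= expectation.unlock.
by apply: eq_integral => w _; rewrite expr2.
Qed.

End Moments.

(** ** Truncated moments *)

Section Truncation.
Variables (R : realType) (p : nat -> R) (V : R).
Hypothesis p_ge0 : forall k, 0 <= p k.
Hypothesis p_mass : (\sum_(0 <= k < n) p k) @[n --> \oo] --> (1 : R).
Hypothesis p_drift : (\sum_(0 <= k < n) p k * (k%:R - 1)) @[n --> \oo] --> (0 : R).
Hypothesis p_var : (\sum_(0 <= k < n) p k * (k%:R - 1) ^+ 2) @[n --> \oo] --> V.

(** Tails of the lower moments are compared with the tail of the second one. *)
Let tail_le (f g : nat -> R) (Sf Sg c : R) n : (0 < n)%N ->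
  (forall k, (n <= k)%N -> 0 <= f k <= c * g k) -> (forall k, 0 <= g k) -> 0 <= c ->
  (\sum_(0 <= k < N) f k) @[N --> \oo] --> Sf ->
  (\sum_(0 <= k < N) g k) @[N --> \oo] --> Sg ->
  0 <= Sf - \sum_(0 <= k < n) f k <= c * Sg.
Proof.
move=> n0 fg g0 c0 cf cg.
have cB : (\sum_(0 <= k < N) f k - \sum_(0 <= k < n) f k) @[N --> \oo] -->
    Sf - \sum_(0 <= k < n) f k by apply: cvgB => //; apply: cvg_cst.
apply/andP; split.
  apply: (cvgr_to_ge cB); near=> N.
  rewrite (@big_cat_nat _ _ _ n 0%N N) //=; last by near: N; exists n.
  rewrite addrAC subrr add0r big_nat_cond; apply: sumr_ge0 => k /andP[/andP[nk _] _].
  by case/andP: (fg k nk).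
have cM : (c * \sum_(0 <= k < N) g k) @[N --> \oo] --> c * Sg.
  by apply: cvgM => //; apply: cvg_cst.
apply: (ler_cvg_to cB cM); near=> N.
rewrite (@big_cat_nat _ _ _ n 0%N N) //=; last by near: N; exists n.
rewrite addrAC subrr add0r mulr_sumr (@big_cat_nat _ _ _ n 0%N N) //=; last first.
  by near: N; exists n.
apply: (@le_trans _ _ (\sum_(n <= k < N) c * g k)).
  rewrite big_nat_cond [leRHS]big_nat_cond; apply: ler_sum => k /andP[/andP[nk _] _].
  by case/andP: (fg k nk).
by rewrite lerDr; apply: sumr_ge0 => k _; rewrite mulr_ge0.
Unshelve. all: by end_near.
Qed.

Lemma mass_trunc_le1 n : \sum_(0 <= k < n) p k <= 1.
Proof.
apply: (cvgr_to_ge p_mass); near=> N.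
rewrite [leRHS](@big_cat_nat _ _ _ n) //=; last by near: N; exists n.
by rewrite lerDl sumr_ge0.
Unshelve. all: by end_near.
Qed.

Lemma var_trunc_le n : \sum_(0 <= k < n) p k * (k%:R - 1) ^+ 2 <= V.
Proof.
apply: (cvgr_to_ge p_var); near=> N.
rewrite [leRHS](@big_cat_nat _ _ _ n) //=; last by near: N; exists n.
by rewrite lerDl sumr_ge0 // => k _; rewrite mulr_ge0 ?sqr_ge0.
Unshelve. all: by end_near.
Qed.

Lemma mass_trunc_ge n : (1 < n)%N ->
  1 - V / n.-1%:R ^+ 2 <= \sum_(0 <= k < n) p k.
Proof.
move=> n1; have n1_gt0 : 0 < n.-1%:R :> R by rewrite ltr0n; lia.
have n2_gt0 : 0 < n.-1%:R ^+ 2 :> R by apply: exprn_gt0.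
suff /andP[_] : 0 <= 1 - \sum_(0 <= k < n) p k <= (n.-1%:R ^+ 2)^-1 * V.
  by rewrite lerBlDr addrC -lerBlDr mulrC.
apply: tail_le p_mass p_var; first exact: ltnW.
- move=> k nk; rewrite p_ge0 /= mulrCA ler_peMr // mulrC ler_pdivlMr // mul1r.
  rewrite lerXn2r ?nnegrE // ?ler0n //.
    by rewrite subr_ge0 ler1n; lia.
  by rewrite lerBrDr natr1 ler_nat; lia.
- by move=> k; rewrite mulr_ge0 ?sqr_ge0.
- by rewrite invr_ge0 ltW.
Qed.

Lemma drift_trunc_le n : (1 < n)%N ->
  `|\sum_(0 <= k < n) p k * (k%:R - 1)| <= V / n.-1%:R.
Proof.
move=> n1; have n1_gt0 : 0 < n.-1%:R :> R by rewrite ltr0n; lia.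
suff /andP[] : 0 <= 0 - \sum_(0 <= k < n) p k * (k%:R - 1) <= n.-1%:R^-1 * V.
  by rewrite sub0r [V / _]mulrC => h1 h2; rewrite ler_norml; lra.
apply: tail_le p_drift p_var; first exact: ltnW.
- move=> k nk.
  have k1 : n.-1%:R <= k%:R - 1 :> R by rewrite lerBrDr natr1 ler_nat; lia.
  have k0 : 0 <= k%:R - 1 :> R by apply: le_trans k1.
  rewrite mulr_ge0 //= mulrCA ler_wpM2l // mulrC ler_pdivlMr // expr2.
  by rewrite ler_wpM2l.
- by move=> k; rewrite mulr_ge0 ?sqr_ge0.
- by rewrite invr_ge0 ltW.
Qed.

Hypothesis V_gt0 : 0 < V.

(** A series with sum 0 and terms of constant sign vanishes termwise; here this
    would make the variance vanish. *)
Let drift_sum0 : (forall k, 0 <= p k * (k%:R - 1)) \/ (forall k, p k * (k%:R - 1) <= 0) ->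
  False.
Proof.
have zero (f : nat -> R) : (forall k, 0 <= f k) ->
    (\sum_(0 <= k < n) f k) @[n --> \oo] --> (0 : R) -> forall k, f k = 0.
  move=> f0 cf k; apply/eqP; rewrite eq_le f0 andbT.
  apply: (cvgr_to_ge cf); near=> N.
  rewrite (bigD1_seq k) ?iota_uniq //=; last first.
    by rewrite mem_index_iota /=; near: N; exists k.+1.
  by rewrite lerDl sumr_ge0.
move=> H.
have dev0 k : p k * (k%:R - 1) = 0.
  case: H => H; first by apply: (zero (fun k => p k * (k%:R - 1))).
  apply/eqP; rewrite -oppr_eq0; apply/eqP.
  apply: (zero (fun k => - (p k * (k%:R - 1)))) => [j|]; first by rewrite oppr_ge0.
  have -> : (fun n => \sum_(0 <= k < n) - (p k * (k%:R - 1))) =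
    (fun n => - \sum_(0 <= k < n) (p k * (k%:R - 1))).
    by apply/funext => n; rewrite sumrN.
  by rewrite -[X in _ --> X]oppr0; apply: cvgN.
have : (fun n => \sum_(0 <= k < n) p k * (k%:R - 1) ^+ 2) = (fun=> 0).
  by apply/funext => n; rewrite big1 // => k _; rewrite expr2 mulrA dev0 mul0r.
move=> V0; move: p_var; rewrite V0 => /(cvg_lim (@Rhausdorff R)) V_eq0.
by move: V_gt0; rewrite -V_eq0 lim_cst ?ltxx //; apply: Rhausdorff.
Unshelve. all: by end_near.
Qed.

Lemma p0_gt0 : 0 < p 0%N.
Proof.
rewrite lt_def p_ge0 andbT; apply/eqP => p0; apply: drift_sum0; left => -[|k].
  by rewrite p0 mul0r.
by rewrite mulr_ge0 // subr_ge0 ler1n.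
Qed.

Lemma p_large_gt0 : exists2 j, (1 < j)%N & 0 < p j.
Proof.
apply: contrapT => no; apply: drift_sum0; right => -[|[|k]].
- by rewrite sub0r mulrN1 oppr_le0.
- by rewrite subrr mulr0.
- suff -> : p k.+2 = 0 by rewrite mul0r.
  apply/eqP/negPn/negP => pk; apply: no; exists k.+2 => //.
  by rewrite lt_def pk p_ge0.
Qed.

Lemma p1_lt1 : p 1%N < 1.
Proof.
apply: (@lt_le_trans _ _ (\sum_(0 <= k < 2) p k)); last exact: mass_trunc_le1.
by rewrite big_nat_recr //= big_nat1 ltrDr p0_gt0.
Qed.

End Truncation.

(** * Large deviations of the number of ones *)

Section Chernoff.
Context (R : realType) (p : nat -> R) (K n : nat).
Hypothesis p_ge0 : forall k, 0 <= p k.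
Hypothesis K1 : (1 < K)%N.
Hypothesis mass_le1 : \sum_(0 <= a < K) p a <= 1.

Let p1_le1 : p 1%N <= 1.
Proof.
apply: le_trans mass_le1; rewrite (bigD1_seq 1%N) ?iota_uniq ?mem_index_iota //=.
by rewrite lerDl sumr_ge0.
Qed.

Lemma expR_sub1_le (x : R) : x <= 1 / 2 -> expR x - 1 <= x + 2 * x ^+ 2.
Proof.
move=> x12; have x1 : 0 < 1 - x by lra.
rewrite lerBlDr; apply: (@le_trans _ _ (1 - x)^-1).
  rewrite -[x in expR x]opprK expRN lef_pV2 ?posrE ?expR_gt0 //.
  exact: expR_ge1Dx.
rewrite -[leLHS]mul1r ler_pdivrMr //.
have x2 : 0 <= x ^+ 2 * (1 - 2 * x) by rewrite mulr_ge0 ?sqr_ge0 //; lra.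
suff : (x + 2 * x ^+ 2 + 1) * (1 - x) = 1 + x ^+ 2 * (1 - 2 * x) by move=> ->; lra.
ring.
Qed.

Lemma exp_moment_ones (theta : R) : theta <= 1 / 2 ->
  \sum_(s <- words K n) wt p s * expR (theta * (count_mem 1%N s)%:R) <=
  expR (n%:R * (p 1%N * (theta + 2 * theta ^+ 2))).
Proof.
move=> th; have E s : wt p s * expR (theta * (count_mem 1%N s)%:R) =
    \prod_(a <- s) (p a * expR (theta * (a == 1%N)%:R)).
  rewrite /wt big_split /=; congr (_ * _).
  elim: s => [|a s IH]; first by rewrite big_nil mulr0 expR0.
  by rewrite big_cons -IH /= natrD mulrDr expRD.
rewrite (eq_bigr _ (fun s _ => E s)) sum_words_prod mulrC expRM_natr.
have sum_ge0 : 0 <= \sum_(0 <= a < K) p a * expR (theta * (a == 1%N)%:R).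
  by apply: sumr_ge0 => a _; rewrite mulr_ge0 ?expR_ge0.
rewrite lerXn2r ?nnegrE ?expR_ge0 //.
have -> : \sum_(0 <= a < K) p a * expR (theta * (a == 1%N)%:R) =
    \sum_(0 <= a < K) p a + p 1%N * (expR theta - 1).
  rewrite (bigD1_seq 1%N) ?iota_uniq ?mem_index_iota //= mulr1.
  rewrite [in RHS](bigD1_seq 1%N) ?iota_uniq ?mem_index_iota //=.
  rewrite (eq_bigr p); last by move=> a /negbTE ->; rewrite mulr0 expR0 mulr1.
  by ring.
apply: (@le_trans _ _ (1 + p 1%N * (theta + 2 * theta ^+ 2))).
  by rewrite lerD // ler_wpM2l // expR_sub1_le.
exact: expR_ge1Dx.
Qed.

(** Chernoff's bound with exponent [delta / 4] on either side. *)
Lemma ones_concentrate (delta : R) : 0 <= delta <= 1 ->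
  \sum_(s <- words K n) wt p s *
     (~~ (`|(count_mem 1%N s)%:R - p 1%N * n%:R| <= delta * n%:R))%:R <=
  2 * expR (- (n%:R * delta ^+ 2 / 8)).
Proof.
move=> /andP[d0 d1]; have [th thE] : exists th, th = delta / 4 by exists (delta / 4).
have th0 : 0 <= th by lra.
have up := @exp_moment_ones th; have lo := @exp_moment_ones (- th).
have {}up := up ltac:(lra); have {}lo := lo ltac:(lra).
pose e1 := expR (- (th * ((p 1%N + delta) * n%:R))).
pose e2 := expR (th * ((p 1%N - delta) * n%:R)).
apply: (@le_trans _ _ (
    (\sum_(s <- words K n) wt p s * expR (th * (count_mem 1%N s)%:R)) * e1 +
    (\sum_(s <- words K n) wt p s * expR (- th * (count_mem 1%N s)%:R)) * e2)).
  rewrite !mulr_suml -big_split; apply: ler_sum => s _ /=.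
  rewrite -!mulrA -mulrDr ler_wpM2l ?wt_ge0 // /e1 /e2 -!expRD.
  set N := (count_mem _ _)%:R.
  case: (lerP `|N - p 1%N * n%:R|) => [_|]; first by rewrite addr_ge0 ?expR_ge0.
  rewrite /= ltr_normr => /orP[h|h].
    apply: le_trans (_ : expR (th * N - th * ((p 1%N + delta) * n%:R)) <= _); last first.
      by rewrite lerDl expR_ge0.
    rewrite -[leLHS]expR0 ler_expR -mulrBr mulr_ge0 //; lra.
  apply: le_trans (_ : expR (- th * N + th * ((p 1%N - delta) * n%:R)) <= _); last first.
    by rewrite lerDr expR_ge0.
  rewrite -[leLHS]expR0 ler_expR mulNr addrC -mulrBr mulr_ge0 //; lra.
have fin (x : R) : x <= 2 * p 1%N * th ^+ 2 - th * delta ->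
    expR (n%:R * x) <= expR (- (n%:R * delta ^+ 2 / 8)).
  move=> hx; rewrite ler_expR -mulrA -mulrN ler_wpM2l //; apply: le_trans hx _.
  have : p 1%N * th ^+ 2 <= th ^+ 2 by rewrite ler_piMl ?sqr_ge0.
  have -> : th * delta = 4 * th ^+ 2 by rewrite thE; field.
  have -> : delta ^+ 2 / 8 = 2 * th ^+ 2 by rewrite thE; field.
  lra.
rewrite mulr_natl mulr2n; apply: lerD.
  apply: le_trans (ler_wpM2r (expR_ge0 _) up) _; rewrite /e1 -expRD.
  apply: le_trans (fin _ (lexx _)); rewrite ler_expR le_eqVlt; apply/orP; left; apply/eqP; ring.
apply: le_trans (ler_wpM2r (expR_ge0 _) lo) _; rewrite /e2 -expRD.
apply: le_trans (fin _ (lexx _)); rewrite ler_expR le_eqVlt; apply/orP; left; apply/eqP; ring.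
Qed.

End Chernoff.

(** * Asymptotics *)

Section Asymptotics.
Variables (R : realType) (p : nat -> R) (V : R).
Hypothesis p_ge0 : forall k, 0 <= p k.
Hypothesis p_mass : (\sum_(0 <= k < n) p k) @[n --> \oo] --> (1 : R).
Hypothesis p_drift : (\sum_(0 <= k < n) p k * (k%:R - 1)) @[n --> \oo] --> (0 : R).
Hypothesis p_var : (\sum_(0 <= k < n) p k * (k%:R - 1) ^+ 2) @[n --> \oo] --> V.
Hypothesis V_gt0 : 0 < V.
Hypothesis p1_gt0 : 0 < p 1%N.

(** The eighth root serves as a scale: n^(-1/8) is the allowed relative
    fluctuation of the number of ones. *)
Definition root8 (n : nat) : R := Num.sqrt (Num.sqrt (Num.sqrt n%:R)).

Lemma root8_ge0 n : 0 <= root8 n.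
Proof. exact: sqrtr_ge0. Qed.

Lemma root8_gt0 n : (0 < n)%N -> 0 < root8 n.
Proof. by move=> n0; rewrite /root8 !sqrtr_gt0 ltr0n. Qed.

Lemma root8X4 n : root8 n ^+ 4 = Num.sqrt n%:R.
Proof. by rewrite (exprM _ 2 2) !sqr_sqrtr ?sqrtr_ge0. Qed.

Lemma root8X8 n : root8 n ^+ 8 = n%:R.
Proof. by rewrite (exprM _ 4 2) root8X4 sqr_sqrtr. Qed.

Lemma root8_ge1 n : (0 < n)%N -> 1 <= root8 n.
Proof.
move=> n0; rewrite -(@ler_pXn2r R 8) ?nnegrE ?root8_ge0 // expr1n root8X8 ler1n //.
Qed.

Lemma root8_near (c : R) : \forall n \near \oo, c <= root8 n.
Proof.
near=> n; apply: le_trans (ler_norm c) _.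
have : `|c| ^+ 8 <= n%:R by near: n; apply: nbhs_infty_ger.
rewrite -root8X8; case: lerP => // lt_c le_c.
by move: le_c; rewrite leNgt ltrXn2r // root8_ge0.
Unshelve. all: by end_near.
Qed.

Lemma ln_le_root8 n : (0 < n)%N -> ln (n%:R : R) <= 8 * root8 n.
Proof.
move=> n0; have y0 := root8_gt0 n0; rewrite -root8X8 lnXn // -[leLHS]mulr_natl ler_wpM2l //.
exact: ltW (ln_sublinear y0).
Qed.

Lemma ln_near (c : R) : \forall n \near \oo, c <= ln (n%:R : R).
Proof.
near=> n; have h : expR c <= n%:R by near: n; apply: nbhs_infty_ger.
by rewrite -[c]expRK ler_ln ?posrE ?expR_gt0 // (lt_le_trans (expR_gt0 c)).
Unshelve. all: by end_near.
Qed.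

(** The exponent, of order sqrt n, is smaller than the exponent n^(3/4) of
    Chernoff's bound for relative deviations 1 / [root8]: atypical words remain
    negligible after conditioning on the size. *)
Lemma luk_mass_subexp : exists2 C : R, 0 <= C &
  \forall n \near \oo, expR (- (C * root8 n ^+ 4)) <= luk_mass p n n.
Proof.
have p00 := p0_gt0 p_ge0 p_drift p_var V_gt0.
have [j j2 pj] := p_large_gt0 p_ge0 p_drift p_var V_gt0.
(* [c] bounds the cost of one correcting letter and [D], of order sqrt n, is the
   fluctuation that Chebyshev's inequality allows. *)
pose c := Num.min (p 0%N) (Num.min (p 1%N) (p j)).
have c_gt0 : 0 < c by rewrite !lt_min p00 p1_gt0.
have c_le1 : c <= 1.
  rewrite (le_trans (_ : c <= p 1%N)) ?(ltW (p1_lt1 p_ge0 p_mass p_drift p_var V_gt0)) //.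
  by rewrite !ge_min lexx orbT.
have [cp0 cp1 cpj] : [/\ c <= p 0%N, c <= p 1%N & c <= p j].
  by rewrite /c !ge_min !lexx !orbT.
pose W := V + 4 * V ^+ 2.
have W0 : 0 < W by rewrite /W ltr_wpDr // mulr_ge0 ?sqr_ge0.
pose B := Num.sqrt (4 * W).
have B0 : 0 <= B by apply: sqrtr_ge0.
have B2 : B ^+ 2 = 4 * W by rewrite sqr_sqrtr // mulr_ge0 // ltW.
pose E := j%:R * (B + 2) * - ln c + 4.
have lnc : 0 <= - ln c by rewrite oppr_ge0 ln_le0.
exists E; first by rewrite addr_ge0 // !mulr_ge0 // addr_ge0.
near=> n.
pose x := Num.sqrt (n%:R : R).
have n_j : (j < n)%N by near: n; exists j.+1.
have n2 : (1 < n)%N by exact: ltn_trans j2 n_j.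
have n0 : 0 < n%:R :> R by rewrite ltr0n; clear -n2; lia.
have n1_gt0 : 0 < n.-1%:R :> R by rewrite ltr0n; clear -n2; lia.
have x2 : x ^+ 2 = n%:R by rewrite sqr_sqrtr.
have x1 : 1 <= x by rewrite -(@sqrtr1 R) ler_sqrt // ler1n; clear -n2; lia.
have half : n%:R <= 2 * n.-1%:R :> R by rewrite -natrM ler_nat; clear -n2; lia.
rewrite root8X4 -/x.
pose D := (Num.truncn (B * x)).+1.
have Bx0 : 0 <= B * x by rewrite mulr_ge0 // (le_trans ler01).
have D_lt : B * x < D%:R by have /andP[] := truncn_itv Bx0.
have D_le : D%:R <= B * x + 1.
  by rewrite /D -natr1 lerD2r; have /andP[] := truncn_itv Bx0.
pose r := (j * D.+1)%N.
have r_le : r%:R <= j%:R * (B + 2) * x.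
  rewrite /r natrM -mulrA ler_wpM2l // -natr1; lra.
have rn : (r <= n)%N.
  rewrite -(ler_nat R); apply: le_trans r_le _.
  rewrite -x2 expr2 ler_wpM2r //; first by rewrite (le_trans ler01).
  rewrite /x -root8X4.
  have big : Num.max 1 (j%:R * (B + 2)) <= root8 n by near: n; apply: root8_near.
  have /andP[y1 yj] : (1 <= root8 n) && (j%:R * (B + 2) <= root8 n).
    by move: big; rewrite ge_max.
  apply: le_trans yj _; rewrite -[leLHS]expr1; apply: ler_weXn2l => //.
have := @luk_mass_lower_bound R p p_ge0 n (V / n.-1%:R) V
  (mass_trunc_le1 p_ge0 p_mass n) (drift_trunc_le p_ge0 p_drift p_var n2)
  (var_trunc_le p_ge0 p_var n) (n - r) D j c.
rewrite -/r subnK // j2 n_j (ltW c_gt0) c_le1 => /(_ isT isT isT cp0 cp1 cpj).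
set a := \sum_(0 <= k < n) p k.
have nr : (n - r)%:R <= n%:R :> R by rewrite ler_nat leq_subr.
have a_ge : 1 - V / n.-1%:R ^+ 2 <= a by apply: mass_trunc_ge p_mass p_var _ _.
have a_le1 : a <= 1 by apply: mass_trunc_le1 p_mass _.
have a_ge0 : 0 <= a by apply: sumr_ge0.
have n_big : 16 * V <= n%:R by near: n; apply: nbhs_infty_ger.
have aN : 3 / 4 <= a ^+ (n - r).
  have bern k : 1 - k%:R * (1 - a) <= a ^+ k.
    elim: k => [|k IH]; first by rewrite mul0r subr0 expr0.
    rewrite exprS; apply: le_trans (_ : a * (1 - k%:R * (1 - a)) <= _).
      have : 0 <= k%:R * (1 - a) ^+ 2 by rewrite mulr_ge0 ?sqr_ge0.
      rewrite -[k.+1%:R]natr1; nra.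
    by rewrite ler_wpM2l.
  apply: le_trans (bern _); rewrite lerBrDr -lerBrDl.
  apply: (@le_trans _ _ (n%:R * (V / n.-1%:R ^+ 2))).
    rewrite ler_pM //; first by rewrite subr_ge0.
    by lra.
  rewrite mulrA ler_pdivrMr ?exprn_gt0 //.
  have : n%:R ^+ 2 <= 4 * n.-1%:R ^+ 2 :> R.
    by rewrite [4](_ : _ = 2 ^+ 2) -?exprMn ?lerXn2r ?nnegrE // -natrX.
  have : 16 * V * n%:R <= n%:R ^+ 2 by rewrite expr2 ler_wpM2r.
  lra.
have D2 : 0 < D%:R ^+ 2 :> R by rewrite exprn_gt0 // ltr0n.
have cheb : ((n - r)%:R * V + (n - r)%:R ^+ 2 * (V / n.-1%:R) ^+ 2) / D%:R ^+ 2 <= 1 / 4.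
  rewrite ler_pdivrMr //.
  have h1 : (n - r)%:R * V <= n%:R * V by rewrite ler_wpM2r // ltW.
  have h2 : (n - r)%:R ^+ 2 * (V / n.-1%:R) ^+ 2 <= 4 * V ^+ 2 * n%:R.
    rewrite -exprMn; apply: (@le_trans _ _ ((2 * V) ^+ 2)).
      rewrite lerXn2r ?nnegrE ?mulr_ge0 ?divr_ge0 ?(ltW V_gt0) //.
      rewrite mulrA ler_pdivrMr // mulrAC ler_wpM2r ?(ltW V_gt0) //.
      exact: le_trans half.
    have -> : (2 * V) ^+ 2 = 4 * V ^+ 2 by ring.
    by apply: ler_peMr; [rewrite mulr_ge0 ?sqr_ge0|rewrite ler1n ltnW].
  have h3 : 4 * W * n%:R <= D%:R ^+ 2.
    rewrite -x2 -B2 -exprMn lerXn2r ?nnegrE //; exact: ltW.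
  move: h3; rewrite /W; lra.
move=> main.
have {}main : c ^+ r * (1 / 2) <= n%:R * luk_mass p n n.
  by apply: le_trans main; rewrite ler_wpM2l ?exprn_ge0 ?(ltW c_gt0) //; lra.
rewrite -(ler_pM2l n0); apply: le_trans main.
have -> : c ^+ r = expR (- (r%:R * - ln c)).
  by rewrite mulrN opprK mulrC expRM_natr lnK ?posrE.
have E1 : r%:R * - ln c <= (E - 4) * x.
  rewrite /E addrK [leRHS]mulrAC ler_wpM2r //.
have e4 : n%:R * 2 <= expR (4 * x).
  rewrite [4 * x]mulrC expRM_natr -x2.
  apply: (@le_trans _ _ ((1 + x) ^+ 4)); last first.
    by rewrite lerXn2r ?nnegrE ?expR_ge0 ?expR_ge1Dx // addr_ge0 // (le_trans ler01).
  have sq : (2 * x) ^+ 2 <= ((1 + x) ^+ 2) ^+ 2.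
    by rewrite lerXn2r ?nnegrE; nra.
  by rewrite (exprM _ 2 2); nra.
have -> : - (E * x) = - ((E - 4) * x) + - (4 * x) by ring.
rewrite expRD mulrCA; apply: (@le_trans _ _ (expR (- ((E - 4) * x)) * (1 / 2))).
  by rewrite ler_wpM2l ?expR_ge0 // expRN ler_pdivrMr ?expR_gt0 //; lra.
by rewrite ler_wpM2r ?ler_expR ?lerN2.
Unshelve. all: by end_near.
Qed.

End Asymptotics.

(** * Long chains *)

Section ChainBounds.
Variables (R : realType) (p : nat -> R) (V : R).
Hypothesis p_ge0 : forall k, 0 <= p k.
Hypothesis p_mass : (\sum_(0 <= k < n) p k) @[n --> \oo] --> (1 : R).
Hypothesis p_drift : (\sum_(0 <= k < n) p k * (k%:R - 1)) @[n --> \oo] --> (0 : R).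
Hypothesis p_var : (\sum_(0 <= k < n) p k * (k%:R - 1) ^+ 2) @[n --> \oo] --> V.
Hypothesis V_gt0 : 0 < V.
Hypothesis p1_gt0 : 0 < p 1%N.

Let typical (n M : nat) : bool :=
  `|M%:R - p 1%N * n%:R| <= (root8 R n)^-1 * n%:R.

Let atypical_small : \forall n \near \oo,
  \sum_(s <- words n n) wt p s * (~~ typical n (count_mem 1%N s))%:R <=
  (root8 R n)^-1 * luk_mass p n n.
Proof.
have [C C0 lowQ] := luk_mass_subexp p_ge0 p_mass p_drift p_var V_gt0 p1_gt0.
near=> n.
have n1 : (1 < n)%N by near: n; exists 2%N.
set y := root8 R n.
have big : 8 * (C + 2) <= y by rewrite /y; near: n; apply: root8_near.
have y1 : 1 <= y by lra.
have y0 : 0 < y by lra.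
have Q : expR (- (C * y ^+ 4)) <= luk_mass p n n by rewrite /y; near: n; exact: lowQ.
have d01 : 0 <= y^-1 <= 1 by rewrite invr_ge0 ltW //= invf_le1.
have conc := @ones_concentrate R p n n p_ge0 n1 (mass_trunc_le1 p_ge0 p_mass n) _ d01.
apply: (le_trans conc).
rewrite -(ler_pM2l y0) mulVKf ?gt_eqF //; apply: le_trans Q.
have -> : n%:R * y^-1 ^+ 2 / 8 = y ^+ 6 / 8.
  by rewrite -(root8X8 R n) -/y; field; rewrite gt_eqF.
apply: (@le_trans _ _ (expR (2 * y) * expR (- (y ^+ 6 / 8)))).
  rewrite mulrA ler_wpM2r ?expR_ge0 //; apply: le_trans (expR_ge1Dx _); lra.
rewrite -expRD ler_expR.
have y4 : y <= y ^+ 4 by rewrite -[leLHS]expr1; apply: ler_weXn2l.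
have y6 : 8 * (C + 2) * y ^+ 4 <= y ^+ 6.
  rewrite (exprD y 2 4) ler_wpM2r ?exprn_ge0 ?(ltW y0) //; apply: le_trans big _.
  by rewrite -[leLHS]expr1; apply: ler_weXn2l.
lra.
Unshelve. all: by end_near.
Qed.

(** For heights of logarithmic order, the expected number of fringe chains of
    height [h] is of order n * p_1 ^ h, and the two bounds are the first and the
    second moment method. *)
Lemma chain_bounds (A : R) : 0 <= A -> exists2 C : R, 0 < C &
  \forall n \near \oo, 0 < luk_mass p n n /\ forall h, h%:R <= A * ln n%:R ->
    \sum_(s <- words n n) wt p s * (luk s && infix (chain_word h) s)%:R <=
      (C * (n%:R * p 1%N ^+ h) + (root8 R n)^-1) * luk_mass p n n /\
    \sum_(s <- words n n) wt p s * (luk s && ~~ infix (chain_word h) s)%:R <=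
      (C / (n%:R * p 1%N ^+ h) + (root8 R n)^-1) * luk_mass p n n.
Proof.
move=> A0.
have p1_lt1 : p 1%N < 1 := p1_lt1 p_ge0 p_mass p_drift p_var V_gt0.
have q0 : 0 < 1 - p 1%N by rewrite subr_gt0.
have p1ne : p 1%N != 0 by rewrite gt_eqF.
(* [k1] and [k2] control the relative deviation of the quotients from [p 1], which
   is of order 1 / [root8]; it is raised to a power [h] of logarithmic order. *)
have [k1 k1E] : exists k1, k1 = (p 1%N)^-1 + 2 by exists ((p 1%N)^-1 + 2).
have [k2 k2E] : exists k2, k2 = (1 + 8 * A) / p 1%N by exists ((1 + 8 * A) / p 1%N).
have k10 : 0 <= k1 by rewrite k1E addr_ge0 // invr_ge0 ltW.
have k20 : 0 <= k2 by rewrite k2E divr_ge0 ?(ltW p1_gt0) // addr_ge0 // mulr_ge0.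
pose C1 := expR (k1 * (8 * A)); pose C2 := 4 / (1 - p 1%N) * expR (2 * k2 * (8 * A)).
have C1_gt0 : 0 < C1 by apply: expR_gt0.
have C2_gt0 : 0 < C2 by rewrite mulr_gt0 ?expR_gt0 // divr_gt0.
have [C C0 lowQ] := luk_mass_subexp p_ge0 p_mass p_drift p_var V_gt0 p1_gt0.
exists (C1 + C2); first exact: addr_gt0.
near=> n.
have n1 : (1 < n)%N by near: n; exists 2%N.
have n0 : 0 < n%:R :> R by rewrite ltr0n ltnW.
set y := root8 R n; set Q := luk_mass p n n.
have Q0 : 0 < Q.
  apply: (@lt_le_trans _ _ (expR (- (C * y ^+ 4)))); first exact: expR_gt0.
  by rewrite /y /Q; near: n; exact: lowQ.
have [ya yb yc] : [/\ 1 <= y, 2 * k2 <= y & 2 / (1 - p 1%N) <= y].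
  have : Num.max 1 (Num.max (2 * k2) (2 / (1 - p 1%N))) <= y.
    by rewrite /y; near: n; apply: root8_near.
  by rewrite !ge_max => /and3P[].
have y0 : 0 < y by lra.
have yne : y != 0 by rewrite gt_eqF.
have atyp : \sum_(s <- words n n) wt p s * (~~ typical n (count_mem 1%N s))%:R <= y^-1 * Q.
  by rewrite /y /Q; near: n; exact: atypical_small.
have ny : y * y <= n%:R.
  rewrite -(root8X8 R n) -/y -expr2; exact: ler_weXn2l.
have yn : y <= n%:R / y by rewrite ler_pdivlMr.
split=> // h hA.
have h8 : h%:R <= 8 * A * y.
  apply: le_trans hA _; rewrite mulrC [8 * A]mulrC -mulrA mulrC ler_wpM2l //.
  exact: ln_le_root8 (ltnW n1).
have hy : h%:R / y <= 8 * A by rewrite ler_pdivrMr.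
have y_inv0 : 0 <= y^-1 by rewrite invr_ge0 ltW.
have np0 : 0 < n%:R * p 1%N ^+ h by rewrite mulr_gt0 ?exprn_gt0.
split.
  pose b := p 1%N * expR (k1 / y).
  apply: le_trans (@chain_upper R p n n p_ge0 n1 (typical n) h b _ _) _.
  - move=> M; rewrite /typical ler_norml => /andP[_ Mup].
    have n1_gt0 : 0 < n.-1%:R :> R by rewrite ltr0n -ltnS prednK // ltnW.
    apply: (@le_trans _ _ (p 1%N * ((1 + (p 1%N)^-1 / y) * (1 + 2 / y)) * n.-1%:R)).
      have -> : p 1%N * ((1 + (p 1%N)^-1 / y) * (1 + 2 / y)) * n.-1%:R =
          (p 1%N + y^-1) * ((1 + 2 / y) * n.-1%:R) by field; rewrite p1ne yne.
      apply: (@le_trans _ _ ((p 1%N + y^-1) * n%:R)); first by move: Mup; rewrite -/y; lra.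
      rewrite ler_wpM2l ?addr_ge0 ?(ltW p1_gt0) //.
      have yn1 : y <= 2 * n.-1%:R.
        apply: (@le_trans _ _ n%:R); first by apply: le_trans ny; rewrite ler_peMl // ltW.
        by rewrite -natrM ler_nat; clear -n1; lia.
      have -> : n%:R = n.-1%:R + 1 :> R by rewrite natr1 prednK // ltnW.
      rewrite mulrDl mul1r lerD2l mulrAC ler_pdivlMr // mul1r //.
    rewrite ler_wpM2r // /b ler_wpM2l ?(ltW p1_gt0) //.
    have -> : k1 / y = (p 1%N)^-1 / y + 2 / y by rewrite k1E mulrDl.
    rewrite expRD ler_pM ?expR_ge1Dx // addr_ge0 // ?divr_ge0 ?invr_ge0 ?ltW //.
  - by rewrite mulr_ge0 ?expR_ge0 // ltW.
  rewrite [leRHS]mulrDl lerD // ler_wpM2r ?(ltW Q0) // /b exprMn [leLHS]mulrA.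
  rewrite [leRHS]mulrC ler_wpM2l ?(ltW np0) //.
  rewrite -expRM_natr; apply: (@le_trans _ _ C1); last by rewrite lerDl ltW.
  by rewrite ler_expR -mulrA ler_wpM2l // mulrC.
pose b := p 1%N * expR (- (2 * k2 / y)); pose l := (1 - p 1%N) / 2 * n%:R.
have b0 : 0 < b by rewrite mulr_gt0 ?expR_gt0.
have l0 : 0 < l by rewrite !mulr_gt0.
apply: le_trans (@chain_lower R p n n p_ge0 n1 (typical n) h b l b0 l0 _) _.
  move=> M; rewrite /typical ler_norml => /andP[]; rewrite -/y => Mlo Mup.
  have bn : b * n%:R <= M%:R - h%:R.
    have k2y : k2 / y <= 1 / 2 by rewrite ler_pdivrMr //; lra.
    apply: (@le_trans _ _ (p 1%N * (1 - k2 / y) * n%:R)).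
      rewrite ler_wpM2r // ler_wpM2l ?(ltW p1_gt0) // expRN.
      have e0 := expR_gt0 (2 * k2 / y).
      rewrite -[leLHS]mul1r ler_pdivrMr //.
      apply: (@le_trans _ _ ((1 - k2 / y) * (1 + 2 * k2 / y))).
        have ky0 : 0 <= k2 / y by rewrite divr_ge0 // ltW.
        rewrite -mulrA; nra.
      by rewrite ler_wpM2l ?expR_ge1Dx //; lra.
    have -> : p 1%N * (1 - k2 / y) * n%:R =
        p 1%N * n%:R - y^-1 * n%:R - 8 * A * (n%:R / y).
      by rewrite k2E; field; rewrite p1ne yne.
    have : 8 * A * y <= 8 * A * (n%:R / y) by rewrite ler_wpM2l // mulr_ge0.
    lra.
  have bn0 : 0 < b * n%:R by rewrite mulr_gt0.
  have hM : (h <= M)%N by rewrite -(ler_nat R) -subr_ge0; lra.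
  have yq : y^-1 * n%:R <= l.
    rewrite ler_wpM2r // -[leLHS]mul1r ler_pdivrMr // mulrAC ler_pdivlMr // mul1r.
    by move: yc; rewrite ler_pdivrMr // mulrC.
  have Mn : (M <= n)%N by rewrite -(ler_nat R); move: yq; rewrite /l; lra.
  by rewrite !natrB //; split=> //; move: yq; rewrite /l; lra.
rewrite [leRHS]mulrDl lerD // ler_wpM2r ?(ltW Q0) //.
rewrite ler_pdivlMr // [leLHS](_ : _ = 4 / (1 - p 1%N) * expR (2 * k2 / y * h%:R)).
  apply: (@le_trans _ _ C2); last by rewrite lerDr ltW.
  rewrite /C2 ler_wpM2l ?divr_ge0 ?(ltW q0) // ler_expR.
  by rewrite -[2 * k2 / y]mulrA -!mulrA !ler_wpM2l // mulrC.
rewrite /l /b exprMn expRN exprVn -expRM_natr.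
have e0 := expR_gt0 (2 * k2 / y * h%:R).
have p1h : p 1%N ^+ h != 0 by rewrite expf_neq0.
by field; rewrite p1h !gt_eqF.
Unshelve. all: by end_near.
Qed.

End ChainBounds.

(** * The conditioned Galton-Watson tree *)

Section ConditionedTree.
Context (R : realType) d0 (T0 : measurableType d0) (P0 : probability T0 R)
  (xi : {RV P0 >-> nat}) d (T : measurableType d) (P : probability T R)
  (X : seq nat -> {RV P >-> nat}).
Hypothesis X_iid : iid_copies xi X.

Let p := offspring xi.

Let p_ge0 k : 0 <= p k. Proof. exact: offspring_ge0. Qed.

Lemma cgw_probE n (E : set ptree) : cgw_prob X n E =
  (\sum_(s <- words n n) wt p s * (luk s && `[< E (dec s) >])%:R) / luk_mass p n n.
Proof.
rewrite /cgw_prob (P_gw_event_size X_iid _ (leqnn n)); congr (_ / _).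
have -> : gw_event X [set t | nnodes t = n] =
    gw_event X setT `&` gw_event X [set t | nnodes t = n].
  by apply/seteqP; split=> w /= => [[t wt' tn]|[_ //]]; split; exists t.
rewrite (P_gw_event_size X_iid _ (leqnn n)) /luk_mass.
by apply: eq_bigr => s _; rewrite asboolT // andbT.
Qed.

Lemma cgw_prob_subadd n (E E1 E2 : set ptree) :
  (forall t, E t -> E1 t \/ E2 t) ->
  cgw_prob X n E <= cgw_prob X n E1 + cgw_prob X n E2.
Proof.
move=> sub; rewrite !cgw_probE -mulrDl ler_wpM2r //.
  rewrite invr_ge0 /luk_mass sumr_ge0 // => s _; rewrite mulr_ge0 ?wt_ge0 //.
rewrite -big_split; apply: ler_sum => s _ /=; rewrite -mulrDr ler_wpM2l ?wt_ge0 //.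
case: (luk s) => /=; last by rewrite addr0.
case: asboolP => [/sub[H|H]|_]; last by rewrite addr_ge0.
  by rewrite (asboolT H) lerDl.
by rewrite (asboolT H) lerDr.
Qed.

Lemma cgw_prob_ge0 n E : 0 <= cgw_prob X n E.
Proof.
rewrite cgw_probE divr_ge0 // /luk_mass sumr_ge0 // => s _;
by rewrite mulr_ge0 ?wt_ge0.
Qed.

Lemma cgw_prob_le n (E E' : set ptree) : E `<=` E' -> cgw_prob X n E <= cgw_prob X n E'.
Proof.
move=> sub; apply: le_trans (@cgw_prob_subadd n E E' set0 _) _.
  by move=> t /sub; left.
rewrite [X in _ + X]cgw_probE big1 ?mul0r ?addr0 // => s _.
by rewrite asboolF // andbF mulr0.
Qed.

Lemma cgw_probC n (E : set ptree) : 0 < luk_mass p n n ->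
  cgw_prob X n E = 1 - cgw_prob X n (~` E).
Proof.
move=> Q0; apply/eqP; rewrite eq_sym subr_eq !cgw_probE -mulrDl.
rewrite -big_split /= (_ : \sum_(s <- words n n) _ = luk_mass p n n) ?divff ?eqxx ?gt_eqF //.
rewrite /luk_mass; apply: eq_bigr => s _; rewrite -mulrDr; congr (_ * _).
rewrite asbool_neg; case: (luk s) => //=; last by rewrite addr0.
by case: asboolP => _; rewrite ?addr0 ?add0r.
Qed.

Hypothesis p0_gt0 : 0 < p 0%N.
Hypothesis p1_gt0 : 0 < p 1%N.

Lemma possible_chain h : possible X (chain h).
Proof.
rewrite /possible (P_gw_event_set1 X_iid) enc_chain lte_fin /chain_word -cats1 wt_cat.
by rewrite /wt big_nseq iter_mulr_1 big_seq1 mulr_gt0 ?exprn_gt0.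
Qed.

Lemma contains_all_unaryE h t :
  contains_all_unary X h t <-> contains_fringe t (chain h).
Proof.
split=> [H|H s [_ [j jh ->]]]; last exact: contains_chain_le jh H.
by apply: H; split; [apply: possible_chain|exists h].
Qed.

Lemma max_unary_heightP t :
  contains_all_unary X (max_unary_height X t) t /\
  forall k, contains_all_unary X k t -> (k <= max_unary_height X t)%N.
Proof.
suff [h hP] : exists h, contains_all_unary X h t /\
    forall k, contains_all_unary X k t -> (k <= h)%N.
  by rewrite /max_unary_height; case: xgetP => [h' _ []|/(_ h)[]].
have ex0 : exists k, `[< contains_all_unary X k t >].
  exists 0%N; apply/asboolP/contains_all_unaryE/contains_chain_infix.
  case/lastP: (enc t) (luk_enc t) => [|w a] //.
  by move=> /andP[/wf_last]; rewrite last_rcons -cats1 => -> _; apply: suffix_infix.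
have ub k : `[< contains_all_unary X k t >] -> (k <= size (enc t))%N.
  move=> /asboolP/contains_all_unaryE/contains_chain_infix/infixP[u [v ->]].
  by rewrite !size_cat size_rcons size_nseq; lia.
case: (ex_maxnP ex0 ub) => h /asboolP hc hmax; exists h; split=> // k /asboolP.
exact: hmax.
Qed.

Variable V : R.
Hypothesis p_mass : (\sum_(0 <= k < n) p k) @[n --> \oo] --> (1 : R).
Hypothesis p_drift : (\sum_(0 <= k < n) p k * (k%:R - 1)) @[n --> \oo] --> (0 : R).
Hypothesis p_var : (\sum_(0 <= k < n) p k * (k%:R - 1) ^+ 2) @[n --> \oo] --> V.
Hypothesis V_gt0 : 0 < V.

Let lam : R := ln (p 1%N)^-1.

Let lam_gt0 : 0 < lam.
Proof.
rewrite /lam ln_gt0 // invf_gt1 //.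
exact: p1_lt1 p_ge0 p_mass p_drift p_var V_gt0.
Qed.

Let np1 n h : (0 < n)%N -> n%:R * p 1%N ^+ h = expR (ln n%:R - h%:R * lam).
Proof.
move=> n0; rewrite expRD lnK ?posrE ?ltr0n //; congr (_ * _).
rewrite /lam lnV ?posrE // mulrN opprK mulrC expRM_natr lnK ?posrE //.
Qed.

(** With [lam] the logarithm of 1 / p_1, the height log n / [lam] is the threshold
    where n * p_1 ^ h equals 1, and a deviation [u] changes this product by the
    factor exp u. *)
Lemma cgw_chain_bounds : exists2 C : R, 0 <= C & \forall n \near \oo,
  0 < luk_mass p n n /\ forall h u, 0 <= u ->
  ((ln n%:R + u) / lam <= h%:R ->
     cgw_prob X n (contains_all_unary X h) <= C * (expR (- u) + (root8 R n)^-1)) /\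
  (h%:R <= (ln n%:R - u) / lam ->
     cgw_prob X n (~` contains_all_unary X h) <= C * (expR (- u) + (root8 R n)^-1)).
Proof.
have A0 : 0 <= 2 / lam + 1 by rewrite addr_ge0 // divr_ge0 // ltW.
have [C C0 bnd] := chain_bounds p_ge0 p_mass p_drift p_var V_gt0 p1_gt0 A0.
exists (C + 1); first by rewrite addr_ge0 // ltW.
near=> n.
have n3 : (2 < n)%N by near: n; exists 3%N.
have [Q0 bnds] : 0 < luk_mass p n n /\ forall h, h%:R <= (2 / lam + 1) * ln n%:R ->
    \sum_(s <- words n n) wt p s * (luk s && infix (chain_word h) s)%:R <=
      (C * (n%:R * p 1%N ^+ h) + (root8 R n)^-1) * luk_mass p n n /\
    \sum_(s <- words n n) wt p s * (luk s && ~~ infix (chain_word h) s)%:R <=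
      (C / (n%:R * p 1%N ^+ h) + (root8 R n)^-1) * luk_mass p n n.
  by near: n; exact: bnd.
split=> // h u u0.
have n0 : (0 < n)%N by apply: ltn_trans n3.
have y_inv0 : 0 <= (root8 R n)^-1 by rewrite invr_ge0 root8_ge0.
have ln1 : 1 <= ln n%:R :> R by near: n; apply: ln_near.
have asE k s : luk s -> `[< contains_all_unary X k (dec s) >] = infix (chain_word k) s.
  move=> ls; apply/asboolP/idP => [/contains_all_unaryE/contains_chain_infix|H].
    by rewrite decK.
  by apply/contains_all_unaryE/contains_chain_infix; rewrite decK.
have upE k : cgw_prob X n (contains_all_unary X k) =
  (\sum_(s <- words n n) wt p s * (luk s && infix (chain_word k) s)%:R) / luk_mass p n n.
  rewrite cgw_probE; congr (_ / _); apply: eq_bigr => s _.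
  by case ls : (luk s) => //; rewrite asE.
have loE k : cgw_prob X n (~` contains_all_unary X k) =
  (\sum_(s <- words n n) wt p s * (luk s && ~~ infix (chain_word k) s)%:R) / luk_mass p n n.
  rewrite cgw_probE; congr (_ / _); apply: eq_bigr => s _.
  by case ls : (luk s) => //; rewrite asbool_neg asE.
split=> [hu|hu].
  (* A larger [u] would lead to heights that are not of logarithmic order. *)
  pose u' := Num.min u (ln n%:R).
  have u'0 : 0 <= u' by rewrite le_min u0 (le_trans ler01).
  have [u'u u'ln] : u' <= u /\ u' <= ln n%:R by rewrite /u' !ge_min !lexx orbT.
  pose x := (ln n%:R + u') / lam.
  have x0 : 0 <= x by rewrite divr_ge0 ?(ltW lam_gt0) // addr_ge0 // (le_trans ler01).
  pose h' := minn h (Num.truncn x).+1.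
  have /andP[tx xt] := truncn_itv x0.
  have xh' : x <= h'%:R.
    rewrite /h' /minn; case: ifP => _; last exact: ltW.
    by apply: le_trans hu; rewrite ler_wpM2r ?invr_ge0 ?(ltW lam_gt0) // lerD2l.
  have h'x : h'%:R <= x + 1.
    by apply: (@le_trans _ _ (Num.truncn x).+1%:R); rewrite ?ler_nat ?geq_minr // -natr1 lerD2r.
  apply: (@le_trans _ _ (cgw_prob X n (contains_all_unary X h'))).
    apply: cgw_prob_le => t /contains_all_unaryE Ht; apply/contains_all_unaryE.
    exact: contains_chain_le (geq_minl _ _) Ht.
  have hA : h'%:R <= (2 / lam + 1) * ln n%:R.
    apply: le_trans h'x _; rewrite mulrDl mul1r lerD // /x mulrAC.
    by rewrite ler_wpM2r ?invr_ge0 ?(ltW lam_gt0) //; lra.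
  have [up _] := bnds h' hA.
  rewrite upE ler_pdivrMr //; apply: le_trans up _; rewrite ler_wpM2r ?(ltW Q0) //.
  rewrite np1 // mulrDl mul1r.
  have e0 := expR_ge0 (- u : R).
  have yln : expR (- ln n%:R) <= (root8 R n)^-1.
    rewrite expRN lnK ?posrE ?ltr0n // lef_pV2 ?posrE ?ltr0n ?root8_gt0 //.
    rewrite -[leRHS](root8X8 R n) -[leLHS]expr1 ler_weXn2l // root8_ge1 //.
  have : expR (ln n%:R - h'%:R * lam) <= expR (- u) + (root8 R n)^-1.
    have le_u' : ln n%:R - h'%:R * lam <= - u'.
      by move: xh'; rewrite /x ler_pdivrMr //; lra.
    apply: (@le_trans _ _ (expR (- u'))); first by rewrite ler_expR.
    rewrite /u'; case: (leP u (ln n%:R)) => _; first by rewrite lerDl.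
    by apply: le_trans yln _; rewrite lerDr.
  by move=> E; have : C * expR (ln n%:R - h'%:R * lam) <= C * (expR (- u) + (root8 R n)^-1);
    [rewrite ler_wpM2l ?(ltW C0)|lra].
have hA : h%:R <= (2 / lam + 1) * ln n%:R.
  apply: le_trans hu _; rewrite ler_pdivrMr // mulrAC mulrDl divfK ?gt_eqF // mul1r mulrDl.
  by have := mulr_ge0 (ltW lam_gt0) (le_trans ler01 ln1); lra.
have [_ low] := bnds h hA.
rewrite loE ler_pdivrMr //; apply: le_trans low _; rewrite ler_wpM2r ?(ltW Q0) //.
rewrite np1 // mulrDl mul1r.
have e0 := expR_ge0 (- u : R).
suff : C * expR (- (ln n%:R - h%:R * lam)) <= C * expR (- u).
  rewrite -expRN; nra.
rewrite ler_wpM2l ?(ltW C0) // ler_expR lerN2 lerBrDr -lerBrDl.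
by move: hu; rewrite ler_pdivlMr //; lra.
Unshelve. all: by end_near.
Qed.

Lemma chain_error_small (C : R) (u : nat -> R) (eps : R) : 0 <= C -> 0 < eps ->
  u n @[n --> \oo] --> +oo ->
  \forall n \near \oo, C * (expR (- u n) + (root8 R n)^-1) <= eps.
Proof.
move=> C0 eps0 /cvgryPge uoo; pose M := (2 * C + 1) / eps.
have M0 : 0 < M by rewrite divr_gt0 // ltr_wpDl // mulr_ge0.
near=> n.
have uM : M <= u n by near: n; exact: uoo.
have yM : M <= root8 R n by near: n; apply: root8_near.
have eu : expR (- u n) <= M^-1.
  rewrite expRN lef_pV2 ?posrE ?expR_gt0 //; apply: le_trans uM _.
  by apply: le_trans (expR_ge1Dx _); rewrite lerDr.
have ey : (root8 R n)^-1 <= M^-1 by rewrite lef_pV2 ?posrE // (lt_le_trans M0).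
apply: (@le_trans _ _ (C * (M^-1 + M^-1))); first by rewrite ler_wpM2l // lerD.
rewrite /M invf_div -mulrDl mulrA ler_pdivrMr; last by rewrite ltr_wpDl // mulr_ge0.
by nra.
Unshelve. all: by end_near.
Qed.

Let cvg0 (a : nat -> R) (b : nat -> R) : (\forall n \near \oo, 0 <= a n <= b n) ->
  (forall eps, 0 < eps -> \forall n \near \oo, b n <= eps) -> a n @[n --> \oo] --> (0 : R).
Proof.
move=> ab bs; apply/cvgr0Pnorm_le => eps eps0; near=> n.
have /andP[a0 abn] : 0 <= a n <= b n by near: n.
by rewrite ger0_norm //; apply: le_trans abn _; near: n; exact: bs.
Unshelve. all: by end_near.
Qed.

Let ge0_near (u : nat -> R) : u n @[n --> \oo] --> +oo -> \forall n \near \oo, 0 <= u n.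
Proof. by move=> /cvgryPge; apply. Qed.

Lemma long_chain_unlikely (u : nat -> R) (h : nat -> nat) :
  u n @[n --> \oo] --> +oo ->
  (\forall n \near \oo, (ln n%:R + u n) / lam <= (h n)%:R) ->
  cgw_prob X n (contains_all_unary X (h n)) @[n --> \oo] --> (0 : R).
Proof.
move=> uoo hu; have [C C0 bnd] := cgw_chain_bounds.
apply: (@cvg0 _ (fun n => C * (expR (- u n) + (root8 R n)^-1))); last first.
  by move=> eps eps0; apply: chain_error_small.
near=> n; rewrite cgw_prob_ge0 /=.
have u0 : 0 <= u n by near: n; exact: ge0_near.
have [Q0 bnds] : 0 < luk_mass p n n /\ forall h u, 0 <= u ->
  ((ln n%:R + u) / lam <= h%:R ->
     cgw_prob X n (contains_all_unary X h) <= C * (expR (- u) + (root8 R n)^-1)) /\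
  (h%:R <= (ln n%:R - u) / lam ->
     cgw_prob X n (~` contains_all_unary X h) <= C * (expR (- u) + (root8 R n)^-1)).
  by near: n; exact: bnd.
by apply: (proj1 (bnds _ _ u0)); near: n.
Unshelve. all: by end_near.
Qed.

Lemma short_chain_likely (u : nat -> R) (h : nat -> nat) :
  u n @[n --> \oo] --> +oo ->
  (\forall n \near \oo, (h n)%:R <= (ln n%:R - u n) / lam) ->
  cgw_prob X n (~` contains_all_unary X (h n)) @[n --> \oo] --> (0 : R).
Proof.
move=> uoo hu; have [C C0 bnd] := cgw_chain_bounds.
apply: (@cvg0 _ (fun n => C * (expR (- u n) + (root8 R n)^-1))); last first.
  by move=> eps eps0; apply: chain_error_small.
near=> n; rewrite cgw_prob_ge0 /=.
have u0 : 0 <= u n by near: n; exact: ge0_near.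
have [Q0 bnds] : 0 < luk_mass p n n /\ forall h u, 0 <= u ->
  ((ln n%:R + u) / lam <= h%:R ->
     cgw_prob X n (contains_all_unary X h) <= C * (expR (- u) + (root8 R n)^-1)) /\
  (h%:R <= (ln n%:R - u) / lam ->
     cgw_prob X n (~` contains_all_unary X h) <= C * (expR (- u) + (root8 R n)^-1)).
  by near: n; exact: bnd.
by apply: (proj2 (bnds _ _ u0)); near: n.
Unshelve. all: by end_near.
Qed.

Lemma whp_complement (E : nat -> set ptree) :
  cgw_prob X n (~` E n) @[n --> \oo] --> (0 : R) -> whp X E.
Proof.
move=> E0; have [C C0 bnd] := cgw_chain_bounds.
rewrite /whp; have : (1 - cgw_prob X n (~` E n)) @[n --> \oo] --> (1 - 0 : R).
  by apply: cvgB => //; apply: cvg_cst.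
rewrite subr0; apply: cvg_trans; apply: near_eq_cvg; near=> n.
have Q0 : 0 < luk_mass p n n.
  by near: n; apply: filterS bnd => n [].
by rewrite (cgw_probC (E n) Q0).
Unshelve. all: by end_near.
Qed.

Lemma ln_cvgy (c b : R) : 0 < c -> (c * ln n%:R - b) @[n --> \oo] --> +oo.
Proof.
move=> c0; apply/cvgryPge => A; near=> n.
rewrite lerBrDr mulrC -ler_pdivrMr //; near: n; exact: ln_near.
Unshelve. all: by end_near.
Qed.

Lemma max_unary_height_concentrated :
  cvg_in_prob X (fun n t => (max_unary_height X t)%:R / (ln n%:R / lam)) 1.
Proof.
(* The cap 1 / 2 keeps the lower threshold positive. *)
move=> eps0 eps0_gt0; pose eps := Num.min eps0 (1 / 2).
have eps_gt0 : 0 < eps by rewrite lt_min eps0_gt0 /=; lra.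
have [eps_le eps_half] : eps <= eps0 /\ eps <= 1 / 2 by rewrite /eps !ge_min !lexx orbT.
pose hi n := (Num.truncn ((1 + eps) * (ln n%:R / lam))).+1.
pose lo n := (Num.truncn ((1 - eps) * (ln n%:R / lam))).+1.
have c_hi : cgw_prob X n (contains_all_unary X (hi n)) @[n --> \oo] --> (0 : R).
  apply: (@long_chain_unlikely (fun n => eps * ln n%:R - 0)); first exact: ln_cvgy.
  near=> n; have l0 : 0 <= ln (n%:R : R) by near: n; apply: ln_near.
  have x0 : 0 <= (1 + eps) * (ln n%:R / lam).
    by rewrite mulr_ge0 ?divr_ge0 ?(ltW lam_gt0) // addr_ge0 // ltW.
  have /andP[_ /ltW] := truncn_itv x0; apply: le_trans.
  by rewrite subr0 le_eqVlt; apply/orP; left; apply/eqP; ring.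
have c_lo : cgw_prob X n (~` contains_all_unary X (lo n)) @[n --> \oo] --> (0 : R).
  apply: (@short_chain_likely (fun n => eps * ln n%:R - lam)); first exact: ln_cvgy.
  near=> n; have l0 : 0 <= ln (n%:R : R) by near: n; apply: ln_near.
  have x0 : 0 <= (1 - eps) * (ln n%:R / lam).
    rewrite mulr_ge0 ?divr_ge0 ?(ltW lam_gt0) //; lra.
  have /andP[lo_le _] := truncn_itv x0; rewrite /lo -natr1.
  have -> : (ln n%:R - (eps * ln n%:R - lam)) / lam = (1 - eps) * (ln n%:R / lam) + 1.
    by field; rewrite gt_eqF.
  by rewrite lerD2r.
have c_sum : (cgw_prob X n (contains_all_unary X (hi n)) +
    cgw_prob X n (~` contains_all_unary X (lo n))) @[n --> \oo] --> (0 : R).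
  by rewrite -[X in _ --> X](addr0 0); apply: cvgD.
apply: cvg0 (fun n => cgw_prob X n (contains_all_unary X (hi n)) +
    cgw_prob X n (~` contains_all_unary X (lo n))) _ _; last first.
  move=> e e0; move/cvgr0Pnorm_le: c_sum => /(_ e e0); apply: filterS => n.
  exact: le_trans (ler_norm _).
near=> n; rewrite cgw_prob_ge0 /=; apply: cgw_prob_subadd => t /=.
have [Hc Hmax] := max_unary_heightP t; set H := max_unary_height X t in Hc Hmax *.
have l0 : 0 < ln (n%:R : R).
  by apply: (@lt_le_trans _ _ 1) => //; near: n; apply: ln_near.
have L0 : 0 < ln n%:R / lam by rewrite divr_gt0.
move=> /(le_lt_trans eps_le); rewrite ltr_normr => /orP[hH|hH].
  left; apply/contains_all_unaryE; move: Hc => /contains_all_unaryE; apply: contains_chain_le.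
  have HL : (1 + eps) * (ln n%:R / lam) < H%:R.
    by rewrite -ltr_pdivlMr //; lra.
  have x0 : 0 <= (1 + eps) * (ln n%:R / lam) by rewrite mulr_ge0 ?(ltW L0) //; lra.
  have /andP[le_x _] := truncn_itv x0.
  by rewrite /hi -(ltr_nat R); apply: le_lt_trans HL.
right => /Hmax; rewrite /lo leqNgt => /negP; apply.
have HL : H%:R < (1 - eps) * (ln n%:R / lam).
  by rewrite -ltr_pdivrMr //; lra.
have x0 : 0 <= (1 - eps) * (ln n%:R / lam) by rewrite mulr_ge0 ?(ltW L0) //; lra.
have /andP[_ lt_x] := truncn_itv x0.
by rewrite -(ltr_nat R); apply: lt_trans HL _.
Unshelve. all: by end_near.
Qed.

End ConditionedTree.

Theorem lemma14 (R : realType)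
  (d0 : measure_display) (T0 : measurableType d0) (P0 : probability T0 R)
  (xi : {RV P0 >-> nat})
  (d : measure_display) (T : measurableType d) (P : probability T R)
  (X : seq nat -> {RV P >-> nat})
  (X_iid : iid_copies xi X)
  (mean_xi : ('E_P0[fun w => (xi w)%:R%R] = 1)%E)
  (var_xi_gt0 : (0 < 'V_P0[fun w => (xi w)%:R%R])%E)
  (var_xi_fin : ('V_P0[fun w => (xi w)%:R%R] < +oo)%E)
  (p1 : R) (p1E : p1 = fine (P0 (xi @^-1` [set 1%N])))
  (p1_gt0 : 0 < p1) :
  (forall (omega : nat -> R) (h : nat -> nat),
     omega n @[n --> \oo] --> +oo ->
     (forall n, (0 < h n)%N) ->
     h n @[n --> \oo] --> \oo ->
     ((\forall n \near \oo, (h n)%:R <= (ln n%:R - omega n) / ln p1^-1) ->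
        whp X (fun n => contains_all_unary X (h n))) /\
     ((\forall n \near \oo, (h n)%:R >= (ln n%:R + omega n) / ln p1^-1) ->
        whp X (fun n => ~` contains_all_unary X (h n))))
  /\
  cvg_in_prob X
    (fun n t => (max_unary_height X t)%:R / (ln n%:R / ln p1^-1)) 1.
Proof.
have [V V_gt0 VE] : exists2 V : R, 0 < V & 'V_P0[fun w => (xi w)%:R%R] = V%:E.
  move: var_xi_gt0 var_xi_fin; case: ('V_P0[_])%E => [V| |] //.
  by rewrite lte_fin => V0 _; exists V.
have p_ge0 := @offspring_ge0 _ _ _ _ xi.
have mass := offspring_mass xi.
have drift := offspring_drift mean_xi.
have var := offspring_var mean_xi VE.
have p0_gt0 := p0_gt0 p_ge0 drift var V_gt0.
have p1_pos : 0 < offspring xi 1 by rewrite /offspring -p1E.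
rewrite p1E -/(offspring xi 1); split; last first.
  exact: (max_unary_height_concentrated X_iid p0_gt0 p1_pos mass drift var V_gt0).
move=> omega h omega_y _ _; split=> [h_le|h_ge].
  apply: (whp_complement X_iid p0_gt0 p1_pos mass drift var V_gt0).
  exact: (short_chain_likely X_iid p0_gt0 p1_pos mass drift var V_gt0 omega_y h_le).
apply: (whp_complement X_iid p0_gt0 p1_pos mass drift var V_gt0).
under eq_cvg do rewrite setCK.
exact: (long_chain_unlikely X_iid p0_gt0 p1_pos mass drift var V_gt0 omega_y h_ge).
Qed.
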